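(* Let $m\ge2$ and $n=2m+1$. Let $X_m\subset\mathbb{A}^{2m}$, $f:\mathbb{A}^{3m}\to\mathbb{A}^{2m}$ and $\pi:\mathbb{A}^{3m}\to\mathbb{A}^{2m+2}$ be as defined in the context. Then the Zariski closure of $\pi(f^{-1}(X_m))$ in $\mathbb{A}^{2m+2}$ equals the hypersurface $V(\alpha_n)$, where the generalized Heron polynomial $\alpha_n$ is regarded as a polynomial in $u_2$ and $\sigma_1,\dots,\sigma_n$ (with $16K^2=-4u_2$).
   Context: Affine spaces are over $\mathbb{C}$. Generalized Heron polynomial. A cyclic $n$-gon is a (possibly non-convex, self-intersecting) oriented $n$-gon inscribed in a circle; its area $K$ is the signed area $\oint x\,dy$. For $n\ge3$, $\alpha_n$ is the unique (up to sign) irreducible polynomial with integer coefficients in $n+1$ variables, homogeneous when the first variable has degree $2$ and the others degree $1$, such that $\alpha_n(16K^2,a_1^2,\dots,a_n^2)=0$ whenever $a_1,\dots,a_n$ are the side lengths of a cyclic $n$-gon of area $K$. It is symmetric in its last $n$ variables, so it is a polynomial in $16K^2$ and the elementary symmetric functions $\sigma_1,\dots,\sigma_n$ of $a_1^2,\dots,a_n^2$; the variable $u_2$ is defined by $u_2=-4K^2$. The variety $X_m$. Use coordinates $(u_2,\dots,u_m,t_{m+1},\dots,t_{2m+1})$ on $\mathbb{A}^{2m}$ and identify such a point with the polynomial $P(z)=\sum_{j=2}^m u_jz^{j-2}+\sum_{j=m+1}^{2m+1}t_jz^{j-2}$. Then $X_m$ is the set of points for which $P(z)=(b_0+b_1z)(c_0+c_1z+\cdots+c_{m-1}z^{m-1})^2$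 for some $b_i,c_j\in\mathbb{C}$ (equivalently, the associated binary form of degree $2m-1$ is zero or has $m-1$ double roots, counted with multiplicity and allowing roots at infinity). The morphism $f$. Use coordinates $(u_2,\dots,u_m,\sigma_1,\dots,\sigma_{2m+1})$ on $\mathbb{A}^{3m}$. Put $u_1=0$ and inductively define polynomials $$t_j=(-1)^{j+1}\sigma_j+\sum_{\substack{1\le i\le m\\1\le j-i\le m}}\frac{t_it_{j-i}}4-\begin{cases}u_j,&j\le m,\\0,&j>m,\end{cases}\qquad j=1,\dots,2m+1 .$$ Then $f$ sends $(u_2,\dots,u_m,\sigma_1,\dots,\sigma_{2m+1})$ to $(u_2,\dots,u_m,t_{m+1},\dots,t_{2m+1})$. The projection $\pi$ is $(u_2,\dots,u_m,\sigma_1,\dots,\sigma_{2m+1})\mapsto(u_2,\sigma_1,\dots,\sigma_{2m+1})$. *)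

(* Defs.v *)
(* R : realType is the field of real numbers and R[i] (from real-closed) the
   field of complex numbers. *)
From HB Require Import structures.
From mathcomp Require Import all_boot all_order all_algebra.
From mathcomp Require Import mpoly.
From mathcomp Require Import boolp classical_sets reals.
From mathcomp Require Import complex.

Set Implicit Arguments.
Unset Strict Implicit.
Unset Printing Implicit Defensive.

Import Order.TTheory GRing.Theory Num.Theory.

Local Open Scope ring_scope.
Local Open Scope classical_set_scope.

(* The points of the affine space A^k over F are the elements of
   k.-tuple F. *)

Section Zariski.
Variables (F : fieldType) (k : nat).

Definition zero_locus (I : set {mpoly F[k]}) : set (k.-tuple F) :=
  [set x | forall p, I p -> p.@[tnth x] = 0].

Definition zariski_closed (Z : set (k.-tuple F)) : Prop :=
  exists I, Z = zero_locus I.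

Definition zariski_closure (S : set (k.-tuple F)) : set (k.-tuple F) :=
  smallest zariski_closed S.

End Zariski.

(* Irreducible elements of an integral domain; the clauses exclude p = 0,
   since 0 = 0 * 0.  Over the integers, irreducible polynomials are in
   particular primitive. *)
Definition irreducible_elt (A : idomainType) (p : A) : Prop :=
  p \isn't a GRing.unit /\
  forall q r : A, p = q * r -> q \is a GRing.unit \/ r \is a GRing.unit.

Section CyclicPolygon.
Variables (R : realType) (n : nat).

Definition dist2 (p q : R * R) : R :=
  Num.sqrt ((p.1 - q.1) ^+ 2 + (p.2 - q.2) ^+ 2).

(* A polygon is the sequence v of its vertices; [ordS i] is the successor of
   i modulo n.  Vertices are allowed to coincide. *)
Definition cyclic_polygon (v : 'I_n -> R * R) : Prop :=
  exists (c : R * R) (r : R), 0 < r /\ forall i, dist2 (v i) c = r.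

Definition side_length (v : 'I_n -> R * R) (i : 'I_n) : R :=
  dist2 (v i) (v (ordS i)).

(* The line integral of x dy along the boundary: on the segment from p to q
   it is (p.1 + q.1) / 2 * (q.2 - p.2). *)
Definition signed_area (v : 'I_n -> R * R) : R :=
  \sum_(i < n) ((v i).1 + (v (ordS i)).1) / 2
                 * ((v (ordS i)).2 - (v i).2).

End CyclicPolygon.

Definition heron_deg n (m : 'X_{1..n.+1}) : nat :=
  (2 * m ord0 + \sum_(i < n) m (lift ord0 i))%N.

Lemma heron_deg0 n : heron_deg (0%MM : 'X_{1..n.+1}) = 0%N.
Proof.
by rewrite /heron_deg mnm0E muln0 add0n big1 // => i _; rewrite mnm0E.
Qed.

Lemma heron_degD n : {morph @heron_deg n : m1 m2 / (m1 + m2)%MM >-> (m1 + m2)%N}.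
Proof.
move=> m1 m2; rewrite /heron_deg mnmDE mulnDr addnACA -big_split /=.
by congr addn; apply: eq_bigr => i _; rewrite mnmDE.
Qed.

HB.instance Definition _ n :=
  isMeasure.Build n.+1 (@heron_deg n) (@heron_deg0 n) (@heron_degD n).

(* alpha is the generalized Heron polynomial for n-gons.  Variable 0 of alpha
   stands for 16 K^2, and variables 1, ..., n for the squared side lengths. *)
Definition is_generalized_heron (R : realType) (n : nat)
    (alpha : {mpoly int[n.+1]}) : Prop :=
  [/\ irreducible_elt alpha,
      alpha \is homog (@heron_deg n) &
      forall v : 'I_n -> R * R, cyclic_polygon v ->
        (map_mpoly intr alpha).@[
          tnth [tuple of 16 * signed_area v ^+ 2
                         :: [tuple side_length v i ^+ 2 | i < n]]] = 0].

(* beta (u_2, sigma_1, ..., sigma_n) is alpha (- 4 u_2, x_1, ..., x_n), where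
   sigma_k is the k-th elementary symmetric polynomial in x_1, ..., x_n: an
   identity in Z[u_2, x_1, ..., x_n], with u_2 as variable 0.  As the sigma_k
   are algebraically independent, alpha determines beta. *)
Definition expressed_in_u2_sigma (n : nat)
    (alpha beta : {mpoly int[n.+1]}) : Prop :=
  let u2 : {mpoly int[n.+1]} := 'X_ord0 in
  let x := [tuple 'X_(lift ord0 i) : {mpoly int[n.+1]} | i < n] in
  let sigma := [tuple mesym n int i.+1 \mPo x | i < n] in
  beta \mPo [tuple of u2 :: sigma] = alpha \mPo [tuple of - 4 * u2 :: x].

(* The values t_0, ..., t_k, where t_0 = 0 is a dummy that the recursion never
   uses. *)
Section TRecursion.
Variables (F : fieldType) (m : nat) (u sigma : nat -> F).

Definition t_step (t : nat -> F) (j : nat) : F :=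
  (-1) ^+ j.+1 * sigma j
  + \sum_(1 <= i < m.+1 | (1 <= j - i <= m)%N) t i * t (j - i)%N / 4
  - (if (j <= m)%N then u j else 0).

Fixpoint t_seq (k : nat) : seq F :=
  if k is k'.+1 then rcons (t_seq k') (t_step (nth 0 (t_seq k')) k) else [:: 0].

Definition t_val (j : nat) : F := (t_seq j)`_j.

Lemma size_t_seq k : size (t_seq k) = k.+1.
Proof. by elim: k => //= k IHk; rewrite size_rcons IHk. Qed.

Lemma nth_t_seq k j : (j <= k)%N -> (t_seq k)`_j = t_val j.
Proof.
elim: k => [|k IHk]; first by rewrite leqn0 => /eqP ->.
rewrite leq_eqVlt => /predU1P [-> //|lt_jk].
by rewrite /= nth_rcons size_t_seq lt_jk IHk.
Qed.

Lemma t_valE j : (1 <= j)%N ->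
  t_val j = (-1) ^+ j.+1 * sigma j
    + \sum_(1 <= i < m.+1 | (1 <= j - i <= m)%N) t_val i * t_val (j - i)%N / 4
    - (if (j <= m)%N then u j else 0).
Proof.
case: j => // j _; rewrite {1}/t_val /= nth_rcons size_t_seq ltnn eqxx.
congr (_ + _ - _); rewrite [LHS]big_nat_cond [RHS]big_nat_cond.
apply: eq_bigr => i /andP [/andP [i_gt0 _] /andP [ji_gt0 _]].
have lt_ij : (i < j.+1)%N by rewrite -subn_gt0.
by rewrite !nth_t_seq // leq_subLR -{1}add1n leq_add2r.
Qed.

End TRecursion.

Section Varieties.
Variables (F : fieldType) (m : nat).

(* A point of A^(2m) with coordinates (u_2, ..., u_m, t_(m+1), ..., t_(2m+1))
   is identified with the polynomial having these coefficients, in this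
   order. *)
Definition X_variety : set ((2 * m).-tuple F) :=
  [set p : (2 * m).-tuple F | exists (b0 b1 : F) (c : 'I_m -> F),
    \poly_(i < 2 * m) p`_i
      = (b0%:P + b1 *: 'X) * (\sum_(k < m) c k *: 'X^k) ^+ 2].

(* The coordinates u_2, ..., u_m, sigma_1, ..., sigma_(2m+1) of a point of
   A^(3m), in this order, with u_1 = 0. *)
Definition u_coord (x : (3 * m).-tuple F) (j : nat) : F :=
  if (j <= 1)%N then 0 else x`_(j - 2).

Definition sigma_coord (x : (3 * m).-tuple F) (j : nat) : F :=
  x`_((m - 1) + (j - 1)).

Definition t_coord (x : (3 * m).-tuple F) (j : nat) : F :=
  t_val m (u_coord x) (sigma_coord x) j.

Definition f_morphism (x : (3 * m).-tuple F) : (2 * m).-tuple F :=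
  [tuple if (i + 2 <= m)%N then u_coord x (i + 2) else t_coord x (i + 2)
  | i < 2 * m].

Definition pi_projection (x : (3 * m).-tuple F) : (2 * m).+2.-tuple F :=
  [tuple of u_coord x 2
         :: [tuple sigma_coord x i.+1 | i < (2 * m).+1]].

End Varieties.

(* Main.v *)
Require Import Defs.
From HB Require Import structures.
From mathcomp Require Import all_boot all_order all_algebra.
From mathcomp Require Import mpoly ring zify.
From mathcomp Require Import boolp classical_sets reals.
From mathcomp Require Import complex.

Set Implicit Arguments.
Unset Strict Implicit.
Unset Printing Implicit Defensive.

Import Order.TTheory GRing.Theory Num.Theory.

Local Open Scope ring_scope.
Local Open Scope classical_set_scope.

(* Put S(z) = 1 - sigma_1 z + sigma_2 z^2 - ... and D(z) = 1 - (t_1 z + ... + t_m z^m) / 2.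
   The recursion for t says D^2 - S = z^2 P(z), so pi (f^-1 (X_m)) consists of the points
   (b_0 c_0^2, sigma) with S = D^2 - z^2 B C^2, where B = b_0 + b_1 z, deg C < m,
   deg D <= m and D(0) = 1.

   alpha vanishes there.  Normalize B = 1 - 4 rho z and substitute
   z = - s / (rho (s - 1)^2): then S(z) = prod_i (1 - x_i z) with
   x_i = rho (2 - q_i - 1/q_i), prod_i q_i = 1 and 4 u_2 = (rho sum_i (q_i - 1/q_i))^2.
   For |q_i| = 1 and rho = r^2 these are the data of a polygon inscribed in a circle of
   radius r, and the vanishing of alpha extends to all complex rho, q_i.

   Conversely, let p vanish on the image.  Its components over a Z-free family of
   coefficients have integer coefficients and vanish at the points with integral D, B, C.
   On these, no nonzero polynomial in sigma vanishes.  As Z[u_2, sigma] is factorial, beta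
   has the same zeros as one of its prime factors, and this factor divides every component:
   otherwise some combination of the two would be a nonzero element of Z[sigma]. *)

(** * Factorial domains *)

Definition divides (A : comNzRingType) (a b : A) : Prop := exists c, b = a * c.

Definition prime_elt (A : idomainType) (p : A) : Prop :=
  [/\ p != 0, p \isn't a GRing.unit &
      forall a b, divides p (a * b) -> divides p a \/ divides p b].

Definition factorial_domain (A : idomainType) : Prop :=
  forall a : A, a != 0 ->
  exists u (s : seq A), [/\ u \is a GRing.unit,
    forall p, p \in s -> prime_elt p & a = u * \prod_(p <- s) p].

Section Factorial.
Variable A : idomainType.
Implicit Types (a b p u : A) (s : seq A).

Lemma prime_irreducible p : prime_elt p -> irreducible_elt p.
Proof.
move=> [p0 pu pP]; split=> // q r e.
have cancelp x y z : p = x * y -> x = p * z -> y \is a GRing.unit.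
  move=> exy ex; apply/unitrPr; exists z; apply: (mulfI p0).
  by rewrite mulr1 [RHS]exy ex -mulrA [y * z]mulrC.
case: (pP q r); first by exists 1; rewrite mulr1 -e.
  by case=> z ez; right; apply: cancelp ez.
by case=> z ez; left; apply: (cancelp r q) ez; rewrite mulrC.
Qed.

(** Each prime of [s] divides [a] or [b] and is cancelled from that side. The equation on sizes
    makes the number of primes additive, as the induction in [factorial_poly] requires. *)
Lemma split_prime_product a b u s : (forall p, p \in s -> prime_elt p) ->
    u \is a GRing.unit -> a * b = u * \prod_(p <- s) p ->
  exists ua ub sa sb, [/\ ua \is a GRing.unit /\ ub \is a GRing.unit,
    a = ua * \prod_(p <- sa) p, b = ub * \prod_(p <- sb) p,
    (size sa + size sb)%N = size s &
    {subset sa <= s} /\ {subset sb <= s}].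
Proof.
elim: s a b u => [|p s IHs] a b u sP uu.
  rewrite big_nil mulr1 => e; move: uu; rewrite -e unitrM => /andP[ua ub].
  by exists a, b, [::], [::]; rewrite !big_nil !mulr1.
have [p0 pu pP] := sP p (mem_head _ _); have sP' q : q \in s -> prime_elt q.
  by move=> qs; apply: sP; rewrite inE qs orbT.
rewrite big_cons => e.
have sub (t : seq A) : {subset t <= s} -> {subset t <= p :: s}.
  by move=> ts x /ts xs; rewrite inE xs orbT.
have subc (t : seq A) : {subset t <= s} -> {subset p :: t <= p :: s}.
  by move=> ts x; rewrite !inE => /orP[->//|/ts->]; rewrite orbT.
case: (pP a b); first by exists (u * \prod_(j <- s) j); rewrite e mulrCA.
- case=> c ec; case: (IHs c b u sP' uu).
    by apply: (mulfI p0); rewrite mulrA -ec e mulrCA.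
  move=> ua [ub [sa [sb [[Hu Hu'] Ha Hb Hs [Sa Sb]]]]].
  exists ua, ub, (p :: sa), sb; split=> //; last by split; auto.
    by rewrite big_cons ec Ha mulrCA.
  by rewrite /= -Hs.
- case=> c ec; case: (IHs a c u sP' uu).
    by apply: (mulfI p0); rewrite mulrCA -ec e mulrCA.
  move=> ua [ub [sa [sb [[Hu Hu'] Ha Hb Hs [Sa Sb]]]]].
  exists ua, ub, sa, (p :: sb); split=> //; last by split; auto.
    by rewrite big_cons ec Hb mulrCA.
  by rewrite /= addnS Hs.
Qed.

(** Split one prime [q] off a factorization of [p]: as [q] is not a unit, its cofactor is, and [p]
    is an associate of [q]. *)
Lemma factorial_irreducible_prime p :
  factorial_domain A -> p != 0 -> irreducible_elt p -> prime_elt p.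
Proof.
move=> UA p0 [pu pP]; have [u [[|q s] [uu sP e]]] := UA p p0.
  by case/negP: pu; rewrite e big_nil mulr1.
have [q0 qu qP] := sP q (mem_head _ _); move: e; rewrite big_cons mulrCA => e.
case: (pP _ _ e) => [qu'|]; first by case/negP: qu.
move: (u * _) e => v e uv.
have pq x : divides p x <-> divides q x.
  split=> [[c ->]|[c ->]]; first by exists (v * c); rewrite e mulrA.
  by exists (v^-1 * c); rewrite e -mulrA mulVKr.
by split=> // a b; rewrite !pq; apply: qP.
Qed.

End Factorial.

Section PolyFactorial.
Variable A : idomainType.
Hypothesis UA : factorial_domain A.
Implicit Types (f g h d : {poly A}) (a c p : A).

Lemma divides_polyC a f : divides a%:P f <-> forall i, divides a f`_i.
Proof.
split=> [[g ->] i|H]; first by exists g`_i; rewrite coefCM.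
exists (\poly_(i < size f) sval (cid (H i))); apply/polyP => i.
rewrite coefCM coef_poly; case: ltnP => [_|le]; first by case: cid.
by rewrite mulr0 nth_default.
Qed.

(** Gauss's lemma. If [p] divides neither factor, let i and j be the lowest indices of coefficients
    that it does not divide; modulo [p], coefficient i + j of the product is the product of these
    two. *)
Lemma prime_polyC p : prime_elt p -> prime_elt p%:P.
Proof.
move=> [p0 pu pP]; split; rewrite ?polyC_eq0 ?poly_unitE //.
  by rewrite coefC /= (negbTE pu) andbF.
move=> f g /divides_polyC pfg; apply/or_asboolP; apply/negPn/negP.
rewrite negb_or => /andP[/asboolPn nf /asboolPn ng].
have ex h : ~ divides p%:P h ->
    exists i, ~ divides p h`_i /\ forall j, (j < i)%N -> divides p h`_j.
  move=> nh; have [i ni] : exists i, `[< ~ divides p h`_i >].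
    apply: contrapT => nex; apply: nh; apply/divides_polyC => i.
    by apply: contrapT => ni; apply: nex; exists i; apply/asboolP.
  have /ex_minnP[k /asboolP nk kmin] : exists i, `[< ~ divides p h`_i >].
    by exists i.
  exists k; split=> // j jk; apply: contrapT => /asboolP /kmin.
  by rewrite leqNgt jk.
have [i [ni mi]] := ex f nf; have [j [nj mj]] := ex g ng.
have dsum (I : Type) (r : seq I) (P : pred I) (F : I -> A) :
    (forall k, P k -> divides p (F k)) -> divides p (\sum_(k <- r | P k) F k).
  move=> H; elim/big_ind: _ => //; first by exists 0; rewrite mulr0.
  by move=> _ _ [x ->] [y ->]; exists (x + y); rewrite mulrDr.
have ij : (i < (i + j).+1)%N by rewrite ltnS leq_addr.
have := pfg (i + j)%N; rewrite coefM (bigD1 (Ordinal ij)) //= addKn => -[c ec].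
case: (pP f`_i g`_j) => //.
have [e ee] : divides p (\sum_(k < (i + j).+1 | k != Ordinal ij)
    f`_k * g`_(i + j - k)).
  apply: dsum => k; rewrite -val_eqE /= neq_ltn => /orP[/mi [x ->]|lt].
    by exists (x * g`_(i + j - k)); rewrite mulrA.
  have /mj [x ->] : (i + j - k < j)%N.
    by rewrite ltn_subLR ?ltn_add2r // -ltnS.
  by exists (f`_k * x); rewrite mulrCA.
by exists (c - e); rewrite mulrBr -ec ee addrK.
Qed.

(** The primes of [a] are cancelled one by one. Each must divide [h]: if it divided the irreducible
    [f], then [f] would be constant. *)
Lemma cancel_polyC f g h a : irreducible_elt f -> (1 < size f)%N -> a != 0 ->
  a%:P * g = f * h -> divides f g.
Proof.
move=> [_ fI] sf a0; have [u [s [uu sP ->]]] := UA a0.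
elim: s sP g h => [_|p s IHs sP] g h.
  rewrite big_nil mulr1 => e; exists (u^-1%:P * h).
  by rewrite mulrCA -e mulrA -polyCM mulVr ?mul1r.
have sP' q : q \in s -> prime_elt q by move=> qs; apply: sP; rewrite inE qs orbT.
have [P0 Pu PP] := prime_polyC (sP p (mem_head _ _)).
rewrite big_cons mulrCA polyCM -mulrA => e.
case: (PP f h); first by exists ((u * \prod_(j <- s) j)%:P * g).
  case=> k ek; case: (fI _ _ ek) => [Pu'|]; first by case/negP: Pu.
  rewrite poly_unitE => /andP[/eqP sk _].
  by move: sf; rewrite ek (size_Cmul _ _) ?sk // -polyC_eq0.
by case=> k ek; apply: (IHs sP' g k); apply: (mulfI P0); rewrite e ek mulrCA.
Qed.

(* A nonzero combination of f and g of minimal degree divides constant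
   multiples of both; cancelling the primes of these constants either makes it
   an associate of f, or a constant. *)
Lemma divides_or_resultant f g : irreducible_elt f -> (1 < size f)%N ->
  divides f g \/ exists s t c, c != 0 /\ c%:P = f * s + g * t.
Proof.
move=> fI sf.
pose J k := `[< exists s t, let d := f * s + g * t in d != 0 /\ size d = k >].
have f0 : f != 0 by rewrite -size_poly_gt0 ltnW.
have exJ : exists k, J k.
  exists (size f); apply/asboolP; exists 1, 0.
  by rewrite /= mulr1 mulr0 addr0.
case: (ex_minnP exJ) => k /asboolP[s [t /= [d0 dk]]] kmin.
set d := f * s + g * t in d0 dk.
(* Pseudo-division by [d]: the remainder is again a combination of [f] and [g], so minimality of the
   degree makes it zero. *)
have dJ x y : exists a q, a != 0 /\ a%:P * (f * x + g * y) = d * q.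
  set e := f * x + g * y.
  exists (lead_coef d ^+ Pdiv.Ring.rscalp e d), (Pdiv.Ring.rdivp e d); split.
    by rewrite expf_neq0 // lead_coef_eq0.
  have := Pdiv.ComRing.rdivp_eq d e; set r := Pdiv.Ring.rmodp e d.
  rewrite -mul_polyC [_ * d]mulrC => er.
  suff r0 : r = 0 by rewrite er r0 addr0.
  apply/eqP/contraT => rN0; have sr : (size r < k)%N by rewrite -dk Pdiv.Ring.ltn_rmodp.
  have : J (size r).
    apply/asboolP; exists ((lead_coef d ^+ Pdiv.Ring.rscalp e d)%:P * x - s * Pdiv.Ring.rdivp e d).
    exists ((lead_coef d ^+ Pdiv.Ring.rscalp e d)%:P * y - t * Pdiv.Ring.rdivp e d).
    have -> : r = (lead_coef d ^+ Pdiv.Ring.rscalp e d)%:P * e - d * Pdiv.Ring.rdivp e d.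
      by rewrite er addrC addKr.
    have -> : f * ((lead_coef d ^+ Pdiv.Ring.rscalp e d)%:P * x - s * Pdiv.Ring.rdivp e d) +
      g * ((lead_coef d ^+ Pdiv.Ring.rscalp e d)%:P * y - t * Pdiv.Ring.rdivp e d) =
      (lead_coef d ^+ Pdiv.Ring.rscalp e d)%:P * e - d * Pdiv.Ring.rdivp e d.
      by rewrite /e /d; ring.
    split=> //; rewrite er addrC addKr; exact: rN0.
  by move/kmin; rewrite leqNgt sr.
have [a [q [a0]]] := dJ 1 0; rewrite mulr1 mulr0 addr0 => eaf.
have [b [r [b0]]] := dJ 0 1; rewrite mulr1 mulr0 add0r => ebg.
(* Each prime of [a] in a f = d q divides [d] or [q]; those taken out of [d] are collected in the
   constant [c]. *)
have {a a0 eaf} [d1 [q1 [c [c0 ef ed]]]] :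
    exists d1 q1 c, [/\ c != 0, f = d1 * q1 & d = c%:P * d1].
  have [u [l [uu lP ea]]] := UA a0.
  move: eaf; rewrite {}ea {a a0}; clear -d0 uu lP.
  elim: l lP d d0 q => [_|p l IHl lP] d d0 q.
    rewrite big_nil mulr1 => e; exists d, (u^-1%:P * q), 1.
    by rewrite oner_neq0 mul1r mulrCA -e mulrA -polyCM mulVr ?mul1r.
  have lP' x : x \in l -> prime_elt x.
    by move=> xl; apply: lP; rewrite inE xl orbT.
  have pp := lP p (mem_head _ _); have [P0 Pu PP] := prime_polyC pp.
  rewrite big_cons mulrCA polyCM -mulrA => e.
  case: (PP d q); first by exists ((u * \prod_(j <- l) j)%:P * f).
    case=> d' ed; have d'0 : d' != 0.
      by apply: contra_neq d0; rewrite ed => ->; rewrite mulr0.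
    case: (IHl lP' d' d'0 q); first by apply: (mulfI P0); rewrite e ed mulrA.
    move=> d1 [q1 [c [c0 -> ed']]]; exists d1, q1, (p * c); split=> //.
      by rewrite mulf_neq0 // -polyC_eq0.
    by rewrite ed ed' polyCM mulrA.
  case=> q' eq; apply: (IHl lP' d d0 q').
  by apply: (mulfI P0); rewrite e eq mulrCA.
case: (fI) => fu /(_ _ _ ef) [|].
  rewrite poly_unitE => /andP[/size_poly1P [v v0 ev] _]; right.
  by exists s, t, (c * v); rewrite mulf_neq0 // polyCM -ev -ed.
move=> uq; left; apply: (@cancel_polyC f g (q1^-1 * c%:P * r) b) => //.
by rewrite ebg ed [in RHS]ef -!mulrA mulVKr // mulrCA.
Qed.

(** Induction on the degree plus the number of primes in the leading coefficient. This measure is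
    additive on products and positive on nonunits, so both members of a proper factorization have a
    smaller one. *)
Lemma factorial_poly : factorial_domain {poly A}.
Proof.
have polyC_unit u : u \is a GRing.unit -> u%:P \is a @GRing.unit {poly A}.
  exact: (rmorph_unit (@polyC A)).
have factC a : a != 0 -> exists (u : {poly A}) (s : seq {poly A}),
    [/\ u \is a GRing.unit, forall p : {poly A}, p \in s -> prime_elt p
      & a%:P = u * \prod_(p <- s) p].
  move=> /UA[u [s [uu sP ->]]]; exists u%:P, (map polyC s); split.
  - exact: polyC_unit.
  - by move=> _ /mapP[p ps ->]; apply/prime_polyC/sP.
  - by rewrite big_map polyCM rmorph_prod.
have main n f u (s : seq A) : u \is a GRing.unit ->
    (forall p, p \in s -> prime_elt p) -> f != 0 ->
    lead_coef f = u * \prod_(p <- s) p -> ((size f).-1 + size s <= n)%N ->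
  exists (v : {poly A}) (l : seq {poly A}), [/\ v \is a GRing.unit,
    forall p : {poly A}, p \in l -> prime_elt p & f = v * \prod_(p <- l) p].
  elim: n f u s => [|n IHn] f u s uu sP f0 lf.
    rewrite leqn0 addn_eq0 => /andP[sf _].
    have [a a0 ->] : exists2 a, a != 0 & f = a%:P.
      by apply/size_poly1P; move: sf f0; rewrite -size_poly_gt0; case: size => [|[]].
    exact: factC.
  move=> le; have [fu|fu] := boolP (f \is a GRing.unit).
    by exists f, [::]; rewrite big_nil mulr1.
  have [/eqP/size_poly1P[a a0 ->]|sf1] := eqVneq (size f) 1%N; first exact: factC.
  have sf : (1 < size f)%N by rewrite ltn_neqAle eq_sym sf1 size_poly_gt0.
  have [fI|fnI] := pselect (irreducible_elt f).
    exists 1, [:: f]; rewrite unitr1 big_seq1 mul1r; split=> // p.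
    rewrite inE => /eqP ->; split=> // g h [k ek].
    (* An irreducible [f] is prime: if it does not divide [g], some nonzero constant [c] is a
       combination of [f] and [g], so [f] divides [c] times [h], and [c] cancels. *)
    case: (divides_or_resultant g fI sf) => [|[x [y [c [c0 ec]]]]]; first by left.
    right; apply: (@cancel_polyC f h (x * h + k * y) c) => //.
    by rewrite ec mulrDl mulrDr !mulrA -ek; ring.
  have [q [r [e qu ru]]] : exists q r, [/\ f = q * r, q \isn't a GRing.unit
      & r \isn't a GRing.unit].
    apply: contrapT => nex; apply: fnI; split=> // q r e.
    apply/orP; apply/negPn; rewrite negb_or; apply/negP => /andP[qu ru].
    by apply: nex; exists q, r.
  have [q0 r0] : q != 0 /\ r != 0.
    by apply/andP; move: f0; rewrite e mulf_eq0 negb_or.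
  move: lf; rewrite e lead_coefM => /(split_prime_product sP uu).
  move=> [ua [ub [sa [sb [[Hu Hu'] Ha Hb ss [Sa Sb]]]]]].
  have pos h v (l : seq A) : h != 0 -> h \isn't a GRing.unit ->
      v \is a GRing.unit ->
      lead_coef h = v * \prod_(p <- l) p -> (0 < (size h).-1 + size l)%N.
    move=> h0 hu vu lh; rewrite lt0n addn_eq0; apply: contra hu.
    move=> /andP[sh /nilP l0]; move: lh; rewrite l0 big_nil mulr1 => lh.
    have [a a0 ea] : exists2 a, a != 0 & h = a%:P.
      by apply/size_poly1P; move: sh h0; rewrite -size_poly_gt0; case: size => [|[]].
    by rewrite ea polyC_unit //; move: lh; rewrite ea lead_coefC => ->.
  have pq := pos q ua sa q0 qu Hu Ha; have pr := pos r ub sb r0 ru Hu' Hb.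
  have sz : ((size f).-1 + size s = ((size q).-1 + size sa) + ((size r).-1 + size sb))%N.
    rewrite e size_mul // -ss addnACA; congr (_ + _)%N.
    move: q0 r0; rewrite -!size_poly_gt0.
    by case: (size q) => // a _; case: (size r) => // b _; rewrite /= addnS.
  case: (IHn q ua sa) => //.
  - by move=> p /Sa/sP.
  - rewrite -ltnS; apply: leq_trans le; rewrite sz -[X in (X < _)%N]addn0.
    by rewrite ltn_add2l.
  move=> v [l [vu lP ->]]; case: (IHn r ub sb) => //.
  - by move=> p /Sb/sP.
  - rewrite -ltnS; apply: leq_trans le; rewrite sz -[X in (X < _)%N]add0n.
    by rewrite ltn_add2r.
  move=> v' [l' [vu' lP' ->]]; exists (v * v'), (l ++ l'); split.
  - by rewrite unitrM vu.
  - by move=> p; rewrite mem_cat => /orP[/lP|/lP'].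
  - by rewrite big_cat mulrACA.
move=> f f0; have [|u [s [uu sP e]]] := UA (a := lead_coef f).
  by rewrite lead_coef_eq0.
exact: (main _ f u s uu sP f0 e (leqnn _)).
Qed.

End PolyFactorial.

Lemma prime_elt_int (p : nat) : prime p -> prime_elt (p%:Z).
Proof.
move=> pp; split.
- by rewrite eqz_nat -lt0n prime_gt0.
- by case: p pp => [|[|p]].
have dvdE a : divides p%:Z a <-> (p %| `|a|)%N.
  change (divides (p%:Z) a <-> (dvdz p%:Z) a).
  by split=> [[c ->]|/dvdzP[c ->]]; [apply: dvdz_mulr|exists c; rewrite mulrC].
move=> a b /dvdE; rewrite abszM Euclid_dvdM // => /orP[H|H]; [left|right]; exact/dvdE.
Qed.

Lemma factorial_int : factorial_domain int.
Proof.
move=> a a0; exists (sgz a), [seq p%:Z | p <- flatten [seq nseq f.2 f.1 | f <- prime_decomp `|a|]].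
split.
- by case: (sgzP a) a0.
- move=> _ /mapP[p /flatten_mapP[[q e] /= qe /nseqP[-> e0]] ->].
  by apply: prime_elt_int; case/mem_prime_decomp: qe.
rewrite {1}[a]intEsg; congr (_ * _); rewrite big_map.
rewrite -(big_morph Posz PoszM (erefl 1%:Z)); congr (Posz _).
rewrite {1}[`|a|%N]prod_prime_decomp ?absz_gt0 // big_flatten big_map /=.
by apply: eq_bigr => -[q e] _ /=; rewrite big_nseq iter_muln_1.
Qed.

Lemma factorial_iso (A B : idomainType) (f : {rmorphism A -> B})
    (g : {rmorphism B -> A}) :
  cancel f g -> cancel g f -> factorial_domain A -> factorial_domain B.
Proof.
move=> fK gK UA b b0; case: (UA (g b)) => [|u [s [uu sP e]]].
  by apply: contra_neq b0 => gb; rewrite -[b]gK gb rmorph0.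
exists (f u), (map f s); split; first exact: rmorph_unit.
  move=> _ /mapP[p /sP[p0 pu pP] ->]; split.
  - by apply: contra_neq p0 => fp; rewrite -[p]fK fp rmorph0.
  - by apply: contra pu => /(rmorph_unit g); rewrite fK.
  have fd x : divides p (g x) -> divides (f p) x.
    by case=> c ec; exists (f c); rewrite -rmorphM -ec gK.
  move=> x y [c ec]; case: (pP (g x) (g y)) => [|/fd|/fd]; [|by left|by right].
  by exists (g c); rewrite -rmorphM ec rmorphM fK.
by rewrite big_map -rmorph_prod -rmorphM -e gK.
Qed.

Lemma mpoly_rmorph_ext (k : nat) (S : nzRingType)
    (f g : {rmorphism {mpoly int[k]} -> S}) :
  (forall i, f 'X_i = g 'X_i) -> f =1 g.
Proof.
move=> fg p; rewrite [p]mpolyE !rmorph_sum; apply: eq_bigr => m _.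
rewrite -mul_mpolyC !rmorphM; congr (_ * _).
  by rewrite -[p@_m]intz (rmorph_int (mpolyC k (R := int))) !rmorph_int.
by rewrite mpolyXE_id !rmorph_prod; apply: eq_bigr => i _; rewrite !rmorphXn fg.
Qed.

Section HeadVariable.
Variable k : nat.

(** Singles out the first variable as a univariate indeterminate, both for the induction on the
    number of variables and for the later elimination of u_2. *)
Definition head_poly : {mpoly int[k.+1]} -> {poly {mpoly int[k]}} :=
  mmap intr (fun i => if unlift ord0 i is Some j then ('X_j)%:P else 'X).

Definition shift_vars : {mpoly int[k]} -> {mpoly int[k.+1]} :=
  mmap intr (fun j => 'X_(lift ord0 j)).

Definition unhead_poly (P : {poly {mpoly int[k]}}) : {mpoly int[k.+1]} :=
  (map_poly shift_vars P).['X_ord0].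

HB.instance Definition _ := GRing.RMorphism.on head_poly.
HB.instance Definition _ := GRing.RMorphism.on shift_vars.

Lemma unhead_poly_additive : additive unhead_poly.
Proof. by move=> P Q; rewrite /unhead_poly rmorphB hornerD hornerN. Qed.

Lemma unhead_poly_multiplicative : multiplicative unhead_poly.
Proof. by split=> [P Q|]; rewrite /unhead_poly ?rmorphM ?rmorph1 ?hornerM ?hornerC. Qed.

HB.instance Definition _ :=
  GRing.isAdditive.Build _ _ unhead_poly unhead_poly_additive.
HB.instance Definition _ :=
  GRing.isMultiplicative.Build _ _ unhead_poly unhead_poly_multiplicative.

Lemma head_polyX0 : head_poly 'X_ord0 = 'X.
Proof. by rewrite /head_poly mmapX mmap1U unlift_none. Qed.

Lemma head_polyXS j : head_poly 'X_(lift ord0 j) = ('X_j)%:P.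
Proof. by rewrite /head_poly mmapX mmap1U liftK. Qed.

Lemma shift_varsX j : shift_vars 'X_j = 'X_(lift ord0 j).
Proof. by rewrite /shift_vars mmapX mmap1U. Qed.

Lemma unhead_polyC p : unhead_poly p%:P = shift_vars p.
Proof. by rewrite /unhead_poly map_polyC hornerC. Qed.

Lemma unhead_polyX : unhead_poly 'X = 'X_ord0.
Proof. by rewrite /unhead_poly map_polyX hornerX. Qed.

Lemma head_polyK : cancel head_poly unhead_poly.
Proof.
apply: (@mpoly_rmorph_ext k.+1 _ (unhead_poly \o head_poly) idfun) => i /=.
case: (unliftP ord0 i) => [j ->|->].
  by rewrite head_polyXS unhead_polyC shift_varsX.
by rewrite head_polyX0 unhead_polyX.
Qed.

Lemma head_shift_vars p : head_poly (shift_vars p) = p%:P.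
Proof.
apply: (@mpoly_rmorph_ext k _ (head_poly \o shift_vars) polyC) => i /=.
by rewrite shift_varsX head_polyXS.
Qed.

Lemma unhead_polyK : cancel unhead_poly head_poly.
Proof.
move=> P; rewrite -[P]coefK poly_def !rmorph_sum; apply: eq_bigr => i _.
rewrite -mul_polyC !rmorphM !rmorphXn /= unhead_polyC unhead_polyX head_polyX0.
by rewrite head_shift_vars.
Qed.

End HeadVariable.

Lemma factorial_mpoly_int k : factorial_domain {mpoly int[k]}.
Proof.
elim: k => [|k IHk].
  apply: (@factorial_iso _ _ (mpolyC 0 (R := int)) (@mcoeff 0 int 0%MM)) factorial_int.
    exact: mpolyCK.
  exact: mpolyKC.
apply: (@factorial_iso _ _ (@unhead_poly k) (@head_poly k)).
- exact: unhead_polyK.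
- exact: head_polyK.
exact: factorial_poly.
Qed.

(** * Density of the integral points *)

Lemma poly_eq0_inj_roots (A : idomainType) (f : nat -> A) (p : {poly A}) :
  injective f -> (forall i, root p (f i)) -> p = 0.
Proof.
move=> f_inj pf; apply/eqP/contraT => p0.
have := max_poly_roots p0 (rs := map f (iota 0 (size p))).
rewrite size_map size_iota ltnn => -> //; last by rewrite map_inj_uniq ?iota_uniq.
by apply/allP => _ /mapP[i _ ->].
Qed.

Lemma digits_lt N n (m : 'I_n -> nat) : (forall j, m j < N)%N ->
  (\sum_(j < n) m j * N ^ j < N ^ n)%N.
Proof.
elim: n m => [|n IHn] m mN; first by rewrite big_ord0.
rewrite big_ord_recr /= expnS; apply: (@leq_trans (N ^ n + m ord_max * N ^ n)).
  by rewrite ltn_add2r; apply: (IHn (fun j => m (widen_ord (leqnSn n) j))).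
by rewrite -mulSn leq_mul2r mN orbT.
Qed.

Lemma digits_inj N n (m m' : 'I_n -> nat) :
  (forall j, m j < N)%N -> (forall j, m' j < N)%N ->
  (\sum_(j < n) m j * N ^ j = \sum_(j < n) m' j * N ^ j)%N -> m =1 m'.
Proof.
elim: n m m' => [|n IHn] m m' mN m'N; first by move=> _ [].
rewrite !big_ord_recr /= => e.
have lt (f : 'I_n.+1 -> nat) : (forall j, f j < N)%N ->
    (\sum_(i < n) f (widen_ord (leqnSn n) i) * N ^ i < N ^ n)%N.
  by move=> fN; apply: (digits_lt (m := fun j => f (widen_ord (leqnSn n) j))).
have Nn : (0 < N ^ n)%N by apply: leq_ltn_trans (lt _ mN).
have emod := congr1 (modn^~ (N ^ n)%N) e.
have ediv := congr1 (divn^~ (N ^ n)%N) e.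
move: emod ediv; rewrite /= ![(_ + _ * N ^ n)%N]addnC !modnMDl !divnMDl //.
rewrite !modn_small ?divn_small ?lt // !addn0 => elo ehi j.
have [i ->|->] := unliftP ord_max j; last exact: ehi.
have -> : lift ord_max i = widen_ord (leqnSn n) i.
  by apply/val_inj; rewrite /= /bump leqNgt ltn_ord.
exact: (IHn _ _ _ _ elo).
Qed.

(* The terms of the substitution have pairwise distinct orders of vanishing at 0, so they
   cannot cancel. *)
Lemma mmap_order_neq0 (A : idomainType) n (e : {mpoly A[n]})
    (a : 'I_n -> nat) (k : 'I_n -> {poly A}) :
    e != 0 -> (forall j, (k j)`_0 != 0) ->
    {in msupp e &, injective (fun m : 'X_{1..n} => \sum_j a j * m j)%N} ->
  mmap polyC (fun j => 'X^(a j) * k j) e != 0.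
Proof.
move=> e0 k0 inj; pose W (m : 'X_{1..n}) := (\sum_j a j * m j)%N.
have exW : exists w, has (fun m => W m == w) (msupp e).
  exists (W (mlead e)); apply/hasP; exists (mlead e) => //.
  exact: mlead_supp.
have [w /hasP[m0 m0e /eqP Wm0] wmin] := ex_minnP exW.
apply/eqP => /(congr1 (fun p : {poly A} => p`_w)); rewrite coef0 /mmap coef_sum.
pose K (m : 'X_{1..n}) := \prod_j k j ^+ m j.
have K0 m : (K m)`_0 != 0.
  rewrite -horner_coef0 horner_prod; apply/prodf_neq0 => j _.
  by rewrite horner_exp expf_neq0 // horner_coef0.
have E m : mmap1 (fun j => 'X^(a j) * k j) m = 'X^(W m) * K m.
  rewrite /mmap1 /W /K -prodrXr -big_split /=; apply: eq_bigr => j _.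
  by rewrite exprMn exprM.
rewrite (bigD1_seq m0) //= big1_seq ?addr0; last first.
  move=> m /andP[mm0 me]; rewrite E coefCM coefXnM.
  have : (w <= W m)%N by apply: wmin; apply/hasP; exists m.
  rewrite leq_eqVlt => /predU1P[wW|->]; last by rewrite mulr0.
  by case/eqP: mm0; apply: inj => //; rewrite -/(W m) -wW -Wm0.
rewrite E coefCM coefXnM Wm0 ltnn subnn => /eqP.
by rewrite mulf_eq0 (negbTE (K0 m0)) orbF mcoeff_eq0 m0e.
Qed.

Lemma mmap_horner (A : comNzRingType) n (e : {mpoly A[n]}) (h : 'I_n -> {poly A}) w :
  (mmap polyC h e).[w] = e.@[fun j => (h j).[w]].
Proof.
rewrite mevalE /mmap horner_sum; apply: eq_bigr => m _.
rewrite hornerCM horner_prod; congr (_ * _).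
by apply: eq_bigr => j _; rewrite horner_exp.
Qed.

(** The common exponent N^n pushes the remainder, of order at least 2 N^n, beyond all linear terms.
    For N large, distinct monomials of [e], translated by [s0], acquire distinct orders in w, so a
    nonzero [e] would restrict to a nonzero polynomial with infinitely many roots. *)
Lemma perturbation_dense n (e : {mpoly int[n]}) (s0 kappa : 'I_n -> int) :
    (forall j, kappa j != 0) ->
    (forall N, exists Q : 'I_n -> {poly int}, forall w : int,
      e.@[fun j => s0 j + kappa j * w ^+ (N ^ n + N ^ j)
                   + w ^+ (2 * N ^ n) * (Q j).[w]] = 0) ->
  e = 0.
Proof.
move=> k0 H; apply/eqP/contraT => e0.
pose e' := e \mPo [tuple 'X_j + (s0 j)%:MP | j < n].
have e'E v : e'.@[v] = e.@[fun j => v j + s0 j].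
  rewrite comp_mpoly_meval; apply: meval_eq => j.
  by rewrite tnth_mktuple mevalD mevalXU mevalC.
have e'0 : e' != 0.
  apply: contra_neq e0 => e'0.
  have : e' \mPo [tuple 'X_j - (s0 j)%:MP | j < n] = e.
    rewrite -[RHS]comp_mpoly_id; pose c t := @comp_mpoly n int n t.
    apply: (mpoly_rmorph_ext (f := c _ \o c _) (g := c _)) => i /=.
    rewrite /c !comp_mpolyXU -!tnth_nth !tnth_mktuple comp_mpolyD comp_mpolyC.
    by rewrite comp_mpolyXU -tnth_nth tnth_mktuple subrK.
  by rewrite e'0 comp_mpoly0.
(* N exceeds every exponent, so that exponents are base-N digits, and N > 1, so that its powers
   increase strictly. *)
pose N := (msize e').+2; have [Q HQ] := H N.
have Nlt (j : 'I_n) : (N ^ j < N ^ n)%N by rewrite ltn_exp2l.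
pose k (j : 'I_n) := (kappa j)%:P + 'X^(N ^ n - N ^ j) * Q j.
pose a (j : 'I_n) := (N ^ n + N ^ j)%N.
suff : mmap polyC (fun j => 'X^(a j) * k j) e' != 0.
  case/eqP; apply: (@poly_eq0_inj_roots _ Posz); first by move=> x y [].
  move=> i; rewrite /root mmap_horner e'E; apply/eqP.
  rewrite -[RHS](HQ i); apply: meval_eq => j.
  rewrite /k /a !hornerE mulrDr addrC addrA [_ * kappa j]mulrC mulrA -exprD.
  by congr (_ + _ ^+ _ * _); rewrite -addnA subnKC ?mul2n ?addnn // ltnW.
apply: mmap_order_neq0 => // [j|m m' me m'e].
  by rewrite /k coefD coefC coefXnM subn_gt0 Nlt addr0.
have lt (x : 'X_{1..n}) : x \in msupp e' -> forall j, (x j < N)%N.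
  move=> xe j; apply: leq_ltn_trans (_ : mdeg x < N)%N; last first.
    by apply: (leq_trans (msize_mdeg_lt xe)); rewrite /N -addn2 leq_addr.
  by rewrite mdegE (bigD1 j) //= leq_addr.
have split (x : 'X_{1..n}) : (\sum_j a j * x j = mdeg x * N ^ n + \sum_(j < n) x j * N ^ j)%N.
  rewrite mdegE big_distrl -big_split /=; apply: eq_bigr => j _.
  by rewrite mulnDl ![(_ * x j)%N]mulnC.
move=> eq; apply/mnmP; apply: (digits_inj (lt _ me) (lt _ m'e)).
(* The order is the total degree times N^n plus the number whose digits are the exponents; modulo
   N^n only the digits remain. *)
move/(congr1 (modn^~ (N ^ n)%N)): eq; rewrite /= !split !modnMDl.
by rewrite !modn_small ?digits_lt //; apply: lt.
Qed.

(** * Integral components of a polynomial *)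

Definition zfree (F : nzRingType) (es : seq F) : Prop :=
  forall a : nat -> int, \sum_(i < size es) (a i)%:~R * es`_i = 0 ->
  forall i, (i < size es)%N -> a i = 0.

(** Elements are treated one at a time. If b c is an integral combination of the family with b
    nonzero, dividing the family by b brings c into its span and keeps it free; otherwise c is
    adjoined. *)
Lemma zfree_span (F : numFieldType) (cs : seq F) : exists es : seq F,
  zfree es /\ forall c, c \in cs ->
    exists a : nat -> int, c = \sum_(i < size es) (a i)%:~R * es`_i.
Proof.
elim: cs => [|c cs [es [free_es span_es]]]; first by exists [::]; split.
have [[b [a [b0 eb]]]|nex] := pselect (exists (b : int) (a : nat -> int),
    b != 0 /\ b%:~R * c = \sum_(i < size es) (a i)%:~R * es`_i).
  have bF0 : (b%:~R : F) != 0 by rewrite intr_eq0.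
  pose es' := [seq x / b%:~R | x <- es].
  have sumE (d : nat -> int) : \sum_(i < size es') (d i)%:~R * es'`_i
      = (\sum_(i < size es) (d i)%:~R * es`_i) / b%:~R.
    rewrite size_map mulr_suml; apply: eq_bigr => i _.
    by rewrite (nth_map 0) ?mulrA.
  exists es'; split=> [d|x].
    rewrite sumE size_map => /(congr1 (fun y => y * b%:~R)).
    by rewrite mulfVK // mul0r => /free_es.
  rewrite inE => /orP[/eqP ->|/span_es[d ->]].
    by exists a; rewrite sumE -eb mulrAC mulfV ?mul1r.
  exists (fun i => d i * b); rewrite (sumE (fun i => d i * b)) /=.
  apply: (canRL (mulfK bF0)); rewrite mulr_suml.
  by apply: eq_bigr => i _; rewrite rmorphM /= mulrAC.
exists (c :: es); split=> [a|x].
  rewrite /= big_ord_recl /= => e.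
  have a0 : a 0%N = 0.
    apply/eqP/contraT => a0; case: nex; exists (a 0%N), (fun i => - a i.+1).
    split=> //; move/eqP: e; rewrite addr_eq0 -sumrN => /eqP ->.
    by apply: eq_bigr => i _; rewrite rmorphN mulNr.
  case=> // i; rewrite ltnS => lt.
  by apply: (free_es (fun i => a i.+1)) => //; rewrite -[RHS]e a0 mul0r add0r.
rewrite inE => /orP[/eqP ->|/span_es[d ->]].
  exists (fun i => (i == 0%N)%:Z); rewrite /= big_ord_recl /= mul1r big1 ?addr0 //.
  by move=> i _; rewrite mul0r.
exists (fun i => if i is i'.+1 then d i' else 0).
by rewrite /= big_ord_recl /= mul0r add0r.
Qed.

Lemma meval_map_mpoly (A B : comNzRingType) (f : {rmorphism A -> B}) n
    (p : {mpoly A[n]}) v :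
  (map_mpoly f p).@[fun j => f (v j)] = f p.@[v].
Proof.
rewrite /map_mpoly /mmap rmorph_sum [in RHS]mevalE rmorph_sum.
apply: eq_bigr => m _; rewrite mmap1_id !rmorphM /= mevalC mevalX rmorph_prod.
by congr (_ * _); apply: eq_bigr => i _; rewrite rmorphXn.
Qed.

Lemma mpoly_zfree_decomposition (F : numFieldType) n (p : {mpoly F[n]}) :
  exists (es : seq F) (ps : nat -> {mpoly int[n]}), zfree es /\
    p = \sum_(i < size es) es`_i *: map_mpoly intr (ps i).
Proof.
have [es [free_es span_es]] := zfree_span [seq p@_m | m <- msupp p].
have /choice [a aE] (m : 'X_{1..n}) : exists a : nat -> int, m \in msupp p ->
    p@_m = \sum_(i < size es) (a i)%:~R * es`_i.
  have [mp|] := boolP (m \in msupp p); last by exists (fun=> 0).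
  by case: (span_es p@_m) => [|a ->]; [apply: map_f|exists a].
exists es, (fun i => \sum_(m <- msupp p) a m i *: 'X_[m]); split=> //.
rewrite [LHS]mpolyE; under [RHS]eq_bigr do
  rewrite rmorph_sum /= scaler_sumr.
rewrite exchange_big /= big_seq [RHS]big_seq; apply: eq_bigr => m mp.
rewrite aE // scaler_suml; apply: eq_bigr => i _.
by rewrite map_mpolyZ map_mpolyX scalerA mulrC.
Qed.

(** At an integral point every component takes an integer value, so the vanishing sum is an integral
    relation in a free family. *)
Lemma zfree_components_vanish (F : numFieldType) n (es : seq F)
    (ps : nat -> {mpoly int[n]}) (v : 'I_n -> int) : zfree es ->
    (\sum_(i < size es) es`_i *: map_mpoly intr (ps i)).@[fun j => (v j)%:~R] = 0 ->
  forall i, (i < size es)%N -> (ps i).@[v] = 0.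
Proof.
move=> free_es; rewrite rmorph_sum /= => e; apply: free_es.
rewrite -[RHS]e; apply: eq_bigr => i _.
by rewrite mevalZ -meval_map_mpoly mulrC.
Qed.

(** * Parametrization of the image by D, B, C *)

Definition pell_params (A : nzRingType) (m : nat) (D B C : {poly A}) : Prop :=
  [/\ D`_0 = 1, (size D <= m.+1)%N, (size B <= 2)%N & (size C <= m)%N].

Definition pell_poly (A : nzRingType) (D B C : {poly A}) : {poly A} :=
  D ^+ 2 - 'X^2 * (B * C ^+ 2).

(** The signs turn the coefficients of S(z) = prod_i (1 - x_i z) into elementary symmetric
    functions; u_2 is the constant coefficient of P = B C^2. *)
Definition pell_point (A : nzRingType) (m : nat) (D B C : {poly A}) :
    (2 * m).+2.-tuple A :=
  [tuple of B`_0 * C`_0 ^+ 2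
         :: [tuple (-1) ^+ i.+1 * (pell_poly D B C)`_i.+1 | i < (2 * m).+1]].

Section PellParametrization.
Variables (F : numFieldType) (m : nat).
Hypothesis hm : (2 <= m)%N.
Implicit Types D B C : {poly F}.

(** The two end terms of the convolution give 2 D_j since D_0 = 1. The rest is the index range of
    the recursion for t, because coefficients of D above m vanish. *)
Lemma coef_sqr_unipotent D j : D`_0 = 1 -> (size D <= m.+1)%N -> (1 <= j)%N ->
  (D ^+ 2)`_j = 2 * D`_j + \sum_(1 <= i < m.+1 | (1 <= j - i <= m)%N) D`_i * D`_(j - i).
Proof.
move=> D0 sD; case: j => // j _.
rewrite expr2 coefM big_ord_recl big_ord_recr /= subn0 subnn D0 mul1r mulr1.
rewrite addrCA addrC -mulr2n mulr_natl; congr (_ + _).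
(* A common bound: both sums extend by zero terms to the indices below N. *)
pose N := (m + j).+2.
pose G i := if (1 <= i <= m)%N && (1 <= j.+1 - i <= m)%N then D`_i * D`_(j.+1 - i) else 0.
have -> : \sum_(1 <= i < m.+1 | (1 <= j.+1 - i <= m)%N) D`_i * D`_(j.+1 - i) =
          \sum_(0 <= i < N) G i.
  rewrite (@big_nat_widen _ _ _ 1 m.+1 N) ?ltnS ?leq_addr //; last by rewrite /N; lia.
  rewrite (@big_nat_widenl _ _ _ 1 0) // big_mkcond /=; apply: eq_bigr => i _.
  by rewrite /G; congr (if _ then _ else _); lia.
have -> : \sum_(i < j) D`_(bump 0 i) * D`_(j.+1 - bump 0 i) =
          \sum_(1 <= i < j.+1) D`_i * D`_(j.+1 - i).
  rewrite big_add1 big_mkord; apply: eq_bigr => i _; by rewrite /bump /= add1n.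
rewrite (@big_nat_widen _ _ _ 1 j.+1 N); last by rewrite /N; lia.
rewrite (@big_nat_widenl _ _ _ 1 0) // big_mkcond /=; apply: eq_bigr => i _.
rewrite /G; case: ifP => [/andP[i0 ij]|nc].
  case: ifP => // /negbT; rewrite negb_and => nc.
  have [mi|im] := ltnP m i; first by rewrite [D`_i]nth_default ?mul0r // (leq_trans sD).
  rewrite [D`_(j.+1 - i)]nth_default ?mulr0 // (leq_trans sD) //; lia.
by case: ifP => //; lia.
Qed.

Lemma size_twisted_square B C : (size B <= 2)%N -> (size C <= m)%N ->
  (size (B * C ^+ 2)%R <= 2 * m)%N.
Proof.
move=> sB sC; have := size_polyMleq B (C ^+ 2).
by have := size_polyMleq C C; rewrite -expr2; lia.
Qed.

(** With D_j = - t_j / 2, the recursion says that (-1)^j sigma_j is coefficient j of D^2 - z^2 P.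
    For j <= m, t_j enters through D_j and u_j through z^2 P; for j > m, D_j = 0 and t_j itself is
    the coefficient of z^2 P. *)
Lemma pi_projection_pell (x : (3 * m).-tuple F) :
    X_variety (f_morphism x) ->
  exists D B C, pell_params m D B C /\ pi_projection x = pell_point m D B C.
Proof.
move=> [b0 [b1 [c eP]]].
pose t := t_val m (u_coord x) (sigma_coord x).
pose D := \poly_(j < m.+1) (if j == 0%N then 1 else - t j / 2).
pose B := b0%:P + b1 *: 'X; pose C := \sum_(k < m) c k *: 'X^k.
have D0 : D`_0 = 1 by rewrite coef_poly.
have sD : (size D <= m.+1)%N by exact: size_poly.
have sB : (size B <= 2)%N.
  rewrite (leq_trans (size_polyD _ _)) // geq_max (leq_trans (size_polyC_leq1 _)) //.
  by rewrite (leq_trans (size_scale_leq _ _)) // size_polyX.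
have sC : (size C <= m)%N.
  rewrite (leq_trans (size_sum _ _ _)) //; apply/bigmax_leqP => k _.
  by rewrite (leq_trans (size_scale_leq _ _)) // size_polyXn.
have Dj j : (1 <= j <= m)%N -> D`_j = - t j / 2.
  by move=> /andP[j1 jm]; rewrite coef_poly ltnS jm; case: j j1 {jm}.
have Pj i : (i < 2 * m)%N -> (B * C ^+ 2)`_i =
    if (i + 2 <= m)%N then u_coord x (i + 2) else t (i + 2)%N.
  move=> im; rewrite /B /C -eP coef_poly im.
  by rewrite -(tnth_nth 0 _ (Ordinal im)) tnth_mktuple.
exists D, B, C; split; first by [].
have u2 : u_coord x 2 = B`_0 * C`_0 ^+ 2.
  have := Pj 0%N; rewrite add0n hm => <-; last lia.
  by rewrite -!horner_coef0 hornerM horner_exp.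
apply/val_inj; rewrite /= u2; congr (_ :: _).
apply: eq_map => i.
have := t_valE m (u_coord x) (sigma_coord x) (ltn0Sn i).
rewrite -/t /pell_poly coefB coefXnM coef_sqr_unipotent //.
have -> : \sum_(1 <= i0 < m.+1 | (1 <= i.+1 - i0 <= m)%N) D`_i0 * D`_(i.+1 - i0) =
   \sum_(1 <= i0 < m.+1 | (1 <= i.+1 - i0 <= m)%N) t i0 * t (i.+1 - i0)%N / 4.
  rewrite big_nat_cond [RHS]big_nat_cond; apply: eq_bigr => k /andP[/andP[k0 km] kk].
  rewrite !Dj //; last by rewrite k0.
  by field.
set s := \sum_(_ <= _ < _ | _) _; move=> et.
(* The convention u_1 = 0 agrees with the absence of a term in z from z^2 P. *)
have -> : (if (i.+1 < 2)%N then 0 else (B * C ^+ 2)`_(i.+1 - 2)) =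
    if (i.+1 <= m)%N then u_coord x i.+1 else t i.+1.
  case: ltnP => i2; first by rewrite ifT /u_coord ?ifT //; lia.
  by rewrite Pj ?subnK //; have := ltn_ord i; lia.
have sgn2 : (-1) ^+ i.+1 * (-1) ^+ i.+1 = 1 :> F by rewrite -expr2 sqrr_sign.
apply: (@mulfI _ ((-1) ^+ i.+1)); first by rewrite signr_eq0.
rewrite mulrA sgn2 mul1r; move: et; rewrite exprS mulN1r mulNr.
set sg := (-1) ^+ i.+1 * _; case: (leqP i.+1 m) => im et.
  by rewrite Dj // [in RHS]et; field.
by rewrite [D`__]nth_default ?(leq_trans sD) // et; ring.
Qed.

(** The u_j are read off z^2 B C^2 and the sigma_j off S. Strong induction in the recursion then
    recovers t_j = - 2 D_j for j <= m, after which t_j for j > m comes out as a coefficient of z^2 B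
    C^2. *)
Lemma pell_pi_projection D B C : pell_params m D B C ->
  exists x : (3 * m).-tuple F, X_variety (f_morphism x) /\
    pi_projection x = pell_point m D B C.
Proof.
move=> [D0 sD sB sC].
pose W := 'X^2 * (B * C ^+ 2); pose S := pell_poly D B C.
(* Positions below m - 1 hold u_2, ..., u_m; the others hold sigma_1, ..., sigma_(2m+1). *)
pose x : (3 * m).-tuple F := [tuple if (i < m - 1)%N then W`_(i + 2)
  else (-1) ^+ (i - (m - 1)).+1 * S`_(i - (m - 1)).+1 | i < 3 * m].
have xE i : (i < 3 * m)%N -> x`_i = if (i < m - 1)%N then W`_(i + 2)
  else (-1) ^+ (i - (m - 1)).+1 * S`_(i - (m - 1)).+1.
  by move=> im; rewrite -(tnth_nth 0 x (Ordinal im)) tnth_mktuple.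
have uE j : (j <= m)%N -> u_coord x j = W`_j.
  move=> jm; rewrite /u_coord /W coefXnM ltnS; case: leqP => // j1.
  by rewrite xE ?ifT ?subnK //; try lia; rewrite /W coefXnM ltnNge j1.
have sE j : (1 <= j <= 2 * m + 1)%N -> sigma_coord x j = (-1) ^+ j * S`_j.
  move=> jm; rewrite /sigma_coord xE ?ifF; try lia.
  by have -> : (m - 1 + (j - 1) - (m - 1)).+1 = j by lia.
have sgE j : (1 <= j <= 2 * m + 1)%N -> (-1) ^+ j.+1 * sigma_coord x j = - S`_j.
  by move=> /sE ->; rewrite exprS mulN1r mulNr mulrA -expr2 sqrr_sign mul1r.
pose t := t_val m (u_coord x) (sigma_coord x).
have SE j : (1 <= j)%N -> S`_j = 2 * D`_j
    + \sum_(1 <= i < m.+1 | (1 <= j - i <= m)%N) D`_i * D`_(j - i) - W`_j.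
  by move=> j1; rewrite /S /pell_poly coefB coef_sqr_unipotent.
have sumE j : (forall i, (1 <= i <= m)%N -> (i < j)%N -> t i = - 2 * D`_i) ->
    \sum_(1 <= i < m.+1 | (1 <= j - i <= m)%N) t i * t (j - i)%N / 4
    = \sum_(1 <= i < m.+1 | (1 <= j - i <= m)%N) D`_i * D`_(j - i).
  move=> H; rewrite big_nat_cond [RHS]big_nat_cond.
  apply: eq_bigr => k /andP[/andP[k0 km] kk]; rewrite !H //; try lia.
  by field.
have tD j : (1 <= j <= m)%N -> t j = - 2 * D`_j.
  elim/ltn_ind: j => j IHj /andP[j1 jm].
  rewrite /t t_valE // -/t sgE; last lia.
  rewrite sumE => [|i im ij]; last exact: IHj.
  by rewrite jm uE // SE //; ring.
have tW j : (m < j <= 2 * m + 1)%N -> t j = W`_j.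
  move=> /andP[mj jm]; rewrite /t t_valE; last lia.
  rewrite -/t sgE; last lia.
  rewrite sumE => [|i im ij]; last exact: tD.
  rewrite leqNgt mj /= SE; last lia.
  by rewrite [D`_j]nth_default ?(leq_trans sD) //; ring.
exists x; split.
  exists B`_0, B`_1, (fun k => C`_k).
  have -> : (B`_0)%:P + B`_1 *: 'X = B.
    apply/polyP => i; rewrite coefD coefC coefZ coefX.
    case: i => [|[|i]] /=; rewrite ?mulr0 ?mulr1 ?addr0 ?add0r //.
    by rewrite nth_default // (leq_trans sB).
  have -> : \sum_(k < m) C`_k *: 'X^k = C.
    by rewrite -poly_def; apply/polyP => i; rewrite coef_poly; case: ltnP => // mi;
       rewrite nth_default // (leq_trans sC).
  apply/polyP => i; rewrite coef_poly; case: ltnP => im; last first.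
    by rewrite nth_default // (leq_trans (size_twisted_square sB sC)).
  rewrite -(tnth_nth 0 _ (Ordinal im)) tnth_mktuple /=.
  have WE : W`_(i + 2) = (B * C ^+ 2)`_i.
    by rewrite /W coefXnM addnK ifF //; lia.
  by rewrite -WE; case: leqP => i2; [rewrite uE | rewrite /t_coord -/t tW //; lia].
apply/val_inj; rewrite /= uE //; congr (_ :: _).
  by rewrite /W coefXnM /= -!horner_coef0 hornerM horner_exp.
apply: eq_map => i; rewrite sE //; have := ltn_ord i; lia.
Qed.

End PellParametrization.

Lemma map_pell_poly (A B : nzRingType) (f : {rmorphism A -> B}) D E C :
  map_poly f (pell_poly D E C) = pell_poly (map_poly f D) (map_poly f E) (map_poly f C).
Proof.
by rewrite /pell_poly rmorphB rmorphXn rmorphM /= map_polyXn rmorphM /= rmorphXn.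
Qed.

(* Near D = 1, B = 1, C = z^(m-1), the linear part of (D, B, C) |-> D^2 - z^2 B C^2 is
   2 dD - 2 z^(m+1) dC - z^(2m) dB, which is onto the polynomials of degree at most 2m+1
   without constant term. *)
Lemma pell_sigma_dense (m : nat) (e : {mpoly int[(2 * m).+1]}) : (1 <= m)%N ->
    (forall D B C : {poly int}, pell_params m D B C ->
       e.@[fun i => (-1) ^+ i.+1 * (pell_poly D B C)`_i.+1] = 0) ->
  e = 0.
Proof.
move=> m1 H; set n := (2 * m).+1 in e H *.
pose s (j : 'I_n) : int := (-1) ^+ j.+1.
(* At the base point S = 1 - z^(2m), which gives [s0]. The factors 2, -2, -1 in [kappa] belong to
   the directions dD, dC and dB, which cover the degrees 1 to m, m+1 to 2m, and 2m+1 of S. *)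
pose s0 j := s j * - (j.+1 == 2 * m)%N%:R.
pose kappa (j : 'I_n) := s j * (if (j < m)%N then 2 else if (j < 2 * m)%N then -2 else -1).
apply: (@perturbation_dense n e s0 kappa) => [j|N].
  by rewrite mulf_neq0 ?signr_eq0 //; case: ifP => // _; case: ifP.
(* The outer indeterminate is the variable of S, the inner one is w; [z] denotes the base value of
   C. The increments [delta], [kap], [b] of D, C, B are chosen so that coefficient j+1 of the linear
   part [L] is a multiple of w^(N^j). *)
pose M := (N ^ n)%N; pose T : {poly {poly int}} := ('X^M)%:P.
pose delta : {poly {poly int}} :=
  \poly_(i < m.+1) (if i is j.+1 then 'X^(N ^ j)%N else 0).
pose kap : {poly {poly int}} := \poly_(k < m) 'X^(N ^ (m + k))%N.
pose b : {poly {poly int}} := ('X^(N ^ (2 * m))%N)%:P.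
pose z : {poly {poly int}} := 'X^(m - 1).
pose D := 1 + T * delta; pose B := 1 + T * b * 'X; pose C := z + T * kap.
pose L : {poly {poly int}} := 2 * delta - 2 * ('X ^+ 2 * z * kap) - b * ('X ^+ 3 * z ^+ 2).
pose Q := delta ^+ 2 - 'X ^+ 2 * (kap ^+ 2 + b * 'X * (2 * z * kap + T * kap ^+ 2)).
have SE : pell_poly D B C = 1 - 'X ^+ 2 * z ^+ 2 + T * L + T ^+ 2 * Q.
  by rewrite /pell_poly /D /B /C /L /Q; ring.
have LE (j : 'I_n) : s j * (L`_j.+1).[1] = kappa j /\
    forall w, (L`_j.+1).[w] = (L`_j.+1).[1] * w ^+ (N ^ j).
  have jn : (j < (2 * m).+1)%N by [].
  have -> : L`_j.+1 = ('X^(N ^ j)%N *+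
      (if (j < m)%N then 2 else 0)) - ('X^(N ^ j)%N *+
      (if (m <= j < 2 * m)%N then 2 else 0)) - 'X^(N ^ j)%N *+ (j == 2 * m :> nat)%N.
    rewrite /L !coefB /z -exprD -exprM -exprD !mulr_natl !coefMn coefXnM coef_poly ltnS.
    congr (_ - _ - _).
    - by case: ifP; rewrite ?mul0rn.
    - case: ltnP => h; first by rewrite ifF ?mul0rn ?mulr0n //; lia.
      rewrite coef_poly; case: ifP => h1; first by rewrite ifT; [congr ('X^(N ^ _) *+ _)|]; lia.
      by rewrite ifF ?mul0rn ?mulr0n //; lia.
    - rewrite /b coefCM coefXn; case: eqP => h.
        have -> : (j = 2 * m :> nat)%N by lia. rewrite eqxx mulr1 mulr1n. reflexivity.
      by rewrite mulr0; have -> : (j == 2 * m :> nat)%N = false by lia.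
  split=> [|w].
    rewrite /kappa; congr (_ * _); rewrite !hornerE !hornerMn !hornerXn !expr1n.
    have -> : (j == 2 * m :> nat)%N = (2 * m <= j)%N by lia.
    by case: (ltnP j m) => h; case: (ltnP j (2 * m)) => h' //=; lia.
  by rewrite !hornerE !hornerMn !hornerXn !expr1n; ring.
clearbody L Q; exists (fun j => s j *: Q`_j.+1) => w.
pose f : {rmorphism {poly int} -> int} := horner_eval w.
rewrite -[RHS](H (map_poly f D) (map_poly f B) (map_poly f C)); last first.
  split.
  - rewrite coef_map /D coefD coef1 coefCM coef_poly mulr0 addr0; exact: (rmorph1 f).
  - rewrite (leq_trans (size_poly _ _)) // (leq_trans (size_polyD _ _)) // geq_max.
    by rewrite size_poly1 /= mul_polyC (leq_trans (size_scale_leq _ _)) ?size_poly.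
  - rewrite (leq_trans (size_poly _ _)) // (leq_trans (size_polyD _ _)) // geq_max.
    by rewrite size_poly1 /= -polyCM mul_polyC (leq_trans (size_scale_leq _ _)) ?size_polyX.
  - rewrite (leq_trans (size_poly _ _)) // (leq_trans (size_polyD _ _)) // geq_max.
    rewrite size_polyXn mul_polyC (leq_trans (size_scale_leq _ _)) ?size_poly ?andbT //; lia.
apply: meval_eq => j; rewrite -map_pell_poly coef_map SE /= /horner_eval.
have [Lk Lw] := LE j.
rewrite !coefD coefN /T -rmorphXn /= !coefCM /z -exprM -exprD coefXn coef1 /= add0r.
rewrite !hornerE Lw -/(s j) -Lk /s0.
have -> : (j.+1 == 2 + (m - 1) * 2)%N = (j.+1 == 2 * m)%N by congr (_ == _); lia.
by rewrite /= hornerMn hornerC exprD [(2 * N ^ n)%N]mulnC exprM /M; ring.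
Qed.

(** * Vanishing of the Heron polynomial on the image *)

(** 16 K^2 and the squared sides of a polygon with squared circumradius [rho] whose successive
    vertices differ by the rotations [q j]. Inverses replace complex conjugates, so that the
    formulas are algebraic. *)
Definition heron_arg (F : fieldType) (n : nat) (rho : F) (q : 'I_n -> F)
    (i : 'I_n.+1) : F :=
  if unlift ord0 i is Some j then rho * (2 - q j - (q j)^-1)
  else - (rho * \sum_j (q j - (q j)^-1)) ^+ 2.

Lemma meval_intr_morph (A B : comNzRingType) (f : {rmorphism A -> B}) n
    (p : {mpoly int[n]}) v :
  (map_mpoly intr p).@[fun j => f (v j)] = f (map_mpoly intr p).@[v].
Proof.
apply: (mpoly_rmorph_ext (f := meval (fun j => f (v j)) \o map_mpoly intr)
  (g := f \o meval v \o map_mpoly intr)) => i /=.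
by rewrite !map_mpolyX !mevalXU.
Qed.

(** * Inscribed polygons from points of the unit circle *)

Section UnitCircle.
Variable R : realType.
Local Open Scope complex_scope.
Local Notation Re := complex.Re.
Local Notation Im := complex.Im.
Implicit Types z w : R[i].

Definition on_unit_circle z : Prop := Re z ^+ 2 + Im z ^+ 2 = 1.

Lemma ReM z w : Re (z * w) = Re z * Re w - Im z * Im w.
Proof. by move: z w => [a b] [c d]. Qed.

Lemma ImM z w : Im (z * w) = Re z * Im w + Im z * Re w.
Proof. by move: z w => [a b] [c d]. Qed.

Lemma unit_circle1 : on_unit_circle 1.
Proof. by rewrite /on_unit_circle /= expr1n expr0n addr0. Qed.

Lemma unit_circleM z w :
  on_unit_circle z -> on_unit_circle w -> on_unit_circle (z * w).
Proof.
rewrite /on_unit_circle ReM ImM => hz hw.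
transitivity ((Re z ^+ 2 + Im z ^+ 2) * (Re w ^+ 2 + Im w ^+ 2)); first by ring.
by rewrite hz hw mulr1.
Qed.

Lemma unit_circle_prod (I : finType) (P : pred I) (q : I -> R[i]) :
  (forall i, on_unit_circle (q i)) -> on_unit_circle (\prod_(i | P i) q i).
Proof.
by move=> hq; elim/big_ind: _ => //; [exact: unit_circle1|exact: unit_circleM].
Qed.

Lemma unit_circle_inv z : on_unit_circle z -> z^-1 = z^*.
Proof.
case: z => a b; rewrite /on_unit_circle /= => h.
have e : (a +i* b) * (a +i* b)^* = 1.
  by apply/eqP; rewrite eq_complex /= -h; apply/andP; split; apply/eqP; ring.
have z0 : a +i* b != 0.
  by apply: contra_eq_neq e => ->; rewrite mul0r eq_sym oner_neq0.
by apply: (mulfI z0); rewrite mulfV // e.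
Qed.

Lemma unit_circleB z : on_unit_circle z ->
  z - z^-1 = (2 * Im z)%:C * 'i.
Proof.
move=> h; rewrite unit_circle_inv //; case: z {h} => a b.
by apply/eqP; rewrite eq_complex /=; apply/andP; split; apply/eqP; ring.
Qed.

Lemma unit_circleD z : on_unit_circle z -> 2 - z - z^-1 = (2 - 2 * Re z)%:C.
Proof.
move=> h; rewrite unit_circle_inv //; case: z {h} => a b.
by apply/eqP; rewrite eq_complex /=; apply/andP; split; apply/eqP; ring.
Qed.

(* Evaluated at the polygon with vertices r q_0 ... q_(i-1). *)
Lemma heron_unit_circle n (alpha : {mpoly int[n.+1]}) (r : R) (q : 'I_n -> R[i]) :
    (forall v : 'I_n -> R * R, cyclic_polygon v ->
      (map_mpoly intr alpha).@[
        tnth [tuple of 16 * signed_area v ^+ 2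
                       :: [tuple side_length v i ^+ 2 | i < n]]] = 0) ->
    0 < r -> (forall i, on_unit_circle (q i)) -> \prod_i q i = 1 ->
  (map_mpoly intr alpha).@[heron_arg (r ^+ 2)%:C q] = 0.
Proof.
move=> halpha r0 hq q1.
pose P (k : nat) := \prod_(j < n | (j < k)%N) q j.
have Pc k : on_unit_circle (P k) by apply: unit_circle_prod.
have PS (i : 'I_n) : P (ordS i) = P i * q i.
  (* At the last index the successor wraps around to 0; the polygon closes because the product of
     all [q j] is 1. *)
  have -> : P (ordS i) = P i.+1.
    rewrite /=; have [lt|ge] := ltnP i.+1 n; first by rewrite modn_small.
    have -> : i.+1 = n by apply/eqP; rewrite eqn_leq ge ltn_ord.
    rewrite modnn /P big_pred0 // -[LHS]q1; apply: eq_bigl => j; exact/esym/ltn_ord.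
  rewrite /P (bigD1 i) //= mulrC; congr (_ * _); apply: eq_bigl => j.
  by rewrite ltnS ltn_neqAle andbC.
pose v (i : 'I_n) := (r * Re (P i), r * Im (P i)).
have cv : cyclic_polygon v.
  exists (0, 0), r; split=> // i; rewrite /dist2 /v /= !subr0 !exprMn -mulrDr.
  by rewrite (Pc i) mulr1 sqrtr_sqr gtr0_norm.
have sv i : side_length v i ^+ 2 = r ^+ 2 * (2 - 2 * Re (q i)).
  rewrite /side_length /dist2 sqr_sqrtr ?addr_ge0 ?sqr_ge0 // /v PS ReM ImM /=.
  have -> : r ^+ 2 * (2 - 2 * Re (q i)) =
    r ^+ 2 * ((Re (P i) ^+ 2 + Im (P i) ^+ 2) *
      (1 + (Re (q i) ^+ 2 + Im (q i) ^+ 2) - 2 * Re (q i))).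
    by rewrite (Pc i) (hq i); ring.
  by ring.
have av : signed_area v = r ^+ 2 * (\sum_i Im (q i)) / 2.
  (* Each term of the line integral is the signed area of the triangle spanned with the centre plus
     a difference of [g], and these differences cancel around the cycle. *)
  rewrite /signed_area; pose g i := r ^+ 2 * (Re (P i) * Im (P i)) / 2.
  rewrite (eq_bigr (fun i => r ^+ 2 * Im (q i) / 2 + (g (ordS i) - g i))); last first.
    move=> i _; rewrite /g /v PS ReM ImM /=.
    have -> : r ^+ 2 * Im (q i) / 2 =
      r ^+ 2 * ((Re (P i) ^+ 2 + Im (P i) ^+ 2) * Im (q i)) / 2.
      by rewrite (Pc i) mul1r.
    by field.
  rewrite big_split /= sumrB [X in _ + (_ - X)](reindex_inj (@ordS_inj n)) subrr addr0.
  by rewrite -mulr_suml -mulr_sumr.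
pose w : 'I_n.+1 -> R := tnth [tuple of 16 * signed_area v ^+ 2
   :: [tuple side_length v i ^+ 2 | i < n]].
rewrite -[RHS](rmorph0 (real_complex R)) -(halpha v cv) -meval_intr_morph.
apply: meval_eq => i; rewrite /heron_arg; case: unliftP => [j ->|->].
  rewrite unit_circleD // -rmorphM /= /w tnthS.
  by rewrite tnth_mktuple sv.
rewrite (eq_bigr (fun j => (2 * Im (q j))%:C * 'i)); last first.
  by move=> j _; rewrite unit_circleB.
rewrite -mulr_suml -rmorph_sum mulrA -rmorphM exprMn sqr_i mulrN1 opprK -rmorphXn.
congr (_ %:C); rewrite /w tnth0 av -mulr_sumr.
by field.
Qed.

(** Rational parametrization of the circle at natural numbers k; the real part 2 / (1 + k^2) - 1
    already separates the points. *)
Lemma unit_circle_infinite : exists f : nat -> R[i],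
  injective f /\ forall k, on_unit_circle (f k) /\ f k != 0.
Proof.
pose d (k : nat) : R := 1 + k%:R ^+ 2.
have d0 k : d k != 0.
  by rewrite gt_eqF // ltr_pwDl // exprn_ge0.
exists (fun k => ((1 - k%:R ^+ 2) / d k) +i* (2 * k%:R / d k)); split.
  move=> k l [e _].
  have : k%:R ^+ 2 = l%:R ^+ 2 :> R.
    have h x : (1 - x%:R ^+ 2) / d x = 2 / d x - 1.
      by have := d0 x; rewrite /d => dx; field.
    move: e; rewrite !h => /addIr /(mulfI _) -/(_ _) e.
    have /invr_inj : (d k)^-1 = (d l)^-1 by apply: e; rewrite pnatr_eq0.
    exact: addrI.
  move/eqP; rewrite eqrXn2 ?ler0n // eqr_nat => /eqP.
  by [].
move=> k; have h : on_unit_circle (((1 - k%:R ^+ 2) / d k) +i* (2 * k%:R / d k)).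
  rewrite /on_unit_circle /= !expr_div_n -mulrDl.
  have -> : (1 - k%:R ^+ 2) ^+ 2 + (2 * k%:R) ^+ 2 = d k ^+ 2 by rewrite /d; ring.
  by rewrite mulfV // expf_neq0.
split=> //; apply/eqP => e; move: h; rewrite e /on_unit_circle /= !expr0n addr0.
by move/eqP; rewrite eq_sym oner_eq0.
Qed.

End UnitCircle.

(** * Extension of identities by Laurent polynomials *)

Section Laurent.
Variable F : fieldType.
Implicit Types f g : F -> F.

(** The value at 0 is left free, since [w^-1] has the default value 0 there. *)
Definition laurent f : Prop :=
  exists (Q : {poly F}) k, forall w, w != 0 -> f w = Q.[w] / w ^+ k.

Lemma laurent_cst c : laurent (fun=> c).
Proof. by exists c%:P, 0%N => w _; rewrite hornerC expr0 divr1. Qed.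

Lemma laurent_id : laurent id.
Proof. by exists 'X, 0%N => w _; rewrite hornerX expr0 divr1. Qed.

Lemma laurent_inv : laurent (fun w => w^-1).
Proof. by exists 1, 1%N => w _; rewrite hornerC mul1r expr1. Qed.

Lemma laurentD f g : laurent f -> laurent g -> laurent (fun w => f w + g w).
Proof.
move=> [P [k hP]] [Q [l hQ]]; exists (P * 'X^l + Q * 'X^k), (k + l)%N => w w0.
by rewrite hP // hQ // !hornerE exprD; field; rewrite !expf_neq0.
Qed.

Lemma laurentM f g : laurent f -> laurent g -> laurent (fun w => f w * g w).
Proof.
move=> [P [k hP]] [Q [l hQ]]; exists (P * Q), (k + l)%N => w w0.
by rewrite hP // hQ // hornerM exprD invfM mulrACA.
Qed.

Lemma laurentN f : laurent f -> laurent (fun w => - f w).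
Proof.
move=> [P [k hP]]; exists (- P), k => w w0.
by rewrite hP // hornerN mulNr.
Qed.

Lemma laurent_sum (I : Type) (r : seq I) (h : I -> F -> F) :
  (forall i, laurent (h i)) -> laurent (fun w => \sum_(i <- r) h i w).
Proof.
move=> H; elim: r => [|i r [P [k hP]]].
  by exists 0, 0%N => w _; rewrite big_nil horner0 mul0r.
have [Q [l hQ]] := laurentD (H i) (ex_intro _ P (ex_intro _ k hP)).
by exists Q, l => w w0; rewrite big_cons hQ.
Qed.

Lemma laurentX f k : laurent f -> laurent (fun w => f w ^+ k).
Proof.
move=> H; elim: k => [|k IHk]; first exact: laurent_cst.
have [Q [l hQ]] := laurentM H IHk.
by exists Q, l => w w0; rewrite exprS hQ.
Qed.

Lemma laurent_prod (I : Type) (r : seq I) (h : I -> F -> F) :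
  (forall i, laurent (h i)) -> laurent (fun w => \prod_(i <- r) h i w).
Proof.
move=> H; elim: r => [|i r [P [k hP]]].
  by exists 1, 0%N => w _; rewrite big_nil hornerC expr0 divr1.
have [Q [l hQ]] := laurentM (H i) (ex_intro _ P (ex_intro _ k hP)).
by exists Q, l => w w0; rewrite big_cons hQ.
Qed.

Lemma laurent_meval n (p : {mpoly F[n]}) (h : 'I_n -> F -> F) :
  (forall i, laurent (h i)) -> laurent (fun w => p.@[fun i => h i w]).
Proof.
move=> H; under [X in laurent X]funext do rewrite mevalE.
apply: laurent_sum => m; apply: laurentM; first exact: laurent_cst.
by apply: laurent_prod => i; apply: laurentX.
Qed.

Lemma laurent_eq0 f (g : nat -> F) : laurent f -> injective g ->
  (forall k, g k != 0 /\ f (g k) = 0) -> forall w, w != 0 -> f w = 0.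
Proof.
move=> [Q [k hQ]] g_inj fg w w0; rewrite hQ //.
suff -> : Q = 0 by rewrite horner0 mul0r.
apply: (poly_eq0_inj_roots g_inj) => i; have [gi0 fi0] := fg i.
have : Q.[g i] / g i ^+ k = 0 by rewrite -hQ.
by move/eqP; rewrite mulf_eq0 invr_eq0 (negbTE (expf_neq0 _ gi0)) orbF.
Qed.

(** The inverses carry a hypothesis of their own, since the inverse of a Laurent polynomial need not
    be one. *)
Lemma laurent_heron_arg n rho (q : 'I_n -> F -> F) :
    laurent rho -> (forall j, laurent (q j)) -> (forall j, laurent (fun w => (q j w)^-1)) ->
  forall i, laurent (fun w => heron_arg (rho w) (q^~ w) i).
Proof.
move=> hr hq hqV i; rewrite /heron_arg; case: unliftP => [j _|_].
  apply: laurentM => //; apply: laurentD; last exact: laurentN.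
  by apply: laurentD; [exact: laurent_cst|exact: laurentN].
apply: laurentN; apply: laurentX; apply: laurentM => //.
by apply: laurent_sum => j; apply: laurentD => //; exact: laurentN.
Qed.

End Laurent.

(** The factors q_0, ..., q_(n-1) are released from the unit circle one at a time, [k] counting the
    free ones, while the last factor keeps the product equal to 1. With all factors on the circle,
    [rho] is first extended from squares of positive integers to all nonzero values. *)
Lemma heron_complex (R : realType) n (alpha : {mpoly int[n.+2]})
    (rho : R[i]) (q : 'I_n.+1 -> R[i]) :
    (forall v : 'I_n.+1 -> R * R, cyclic_polygon v ->
      (map_mpoly intr alpha).@[
        tnth [tuple of 16 * signed_area v ^+ 2
                       :: [tuple side_length v i ^+ 2 | i < n.+1]]] = 0) ->
    rho != 0 -> (forall i, q i != 0) -> \prod_i q i = 1 ->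
  (map_mpoly intr alpha).@[heron_arg rho q] = 0.
Proof.
move=> halpha rho0 q0 q1.
suff V k : forall q : 'I_n.+1 -> R[i], (forall i, q i != 0) -> \prod_i q i = 1 ->
    (forall i : 'I_n.+1, (k <= i < n)%N -> on_unit_circle (q i)) ->
    (map_mpoly intr alpha).@[heron_arg rho q] = 0.
  by apply: (V n) => // i; rewrite leqNgt; case: ltnP.
elim: k {q q0 q1} => [|k IHk] q q0 q1 qc.
  have {}qc i : on_unit_circle (q i).
    have [lt|ge] := ltnP i n; first exact: qc.
    have -> : i = ord_max by apply/val_inj/eqP; rewrite eqn_leq ge -ltnS ltn_ord.
    pose P := \prod_(j < n) q (widen_ord (leqnSn n) j).
    have Pc : on_unit_circle P.
      by apply: unit_circle_prod => j; apply: qc; rewrite /= ltn_ord.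
    have -> : q ord_max = P^-1.
      move: q1; rewrite big_ord_recr /= -/P => e.
      by rewrite -[RHS]mulr1 -e mulKf //; apply: contra_eq_neq e => ->;
         rewrite mul0r eq_sym oner_neq0.
    rewrite unit_circle_inv // /on_unit_circle; move: Pc; rewrite /on_unit_circle.
    by case: P => a b /=; rewrite sqrrN.
  pose f r := (map_mpoly intr alpha).@[heron_arg r q].
  apply: (@laurent_eq0 _ f (fun l => (l.+1%:R ^+ 2)%:C%C)) => //.
  - apply: laurent_meval => i; apply: (@laurent_heron_arg _ _ id (fun j _ => q j)).
    + exact: laurent_id.
    + by move=> j; apply: laurent_cst.
    + by move=> j; apply: laurent_cst.
  - move=> a b /complexI /eqP; rewrite eqrXn2 ?ler0n // eqr_nat eqSS => /eqP.
    by [].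
  - move=> l; split; first by rewrite fmorph_eq0 expf_neq0 // pnatr_eq0.
    by apply: heron_unit_circle => //; rewrite ltr0n.
have [kn|nk] := ltnP k n; last by apply: IHk => // i; lia.
have kn' : (k < n.+1)%N by rewrite ltnS ltnW.
pose j := Ordinal kn'; have jmax : j != ord_max by rewrite -val_eqE /= ltn_eqF.
(* q_k becomes the parameter w and the last factor absorbs the change; for w on the circle the
   induction hypothesis applies. *)
pose qw i w := if i == j then w else
  if i == ord_max then q ord_max * q j / w else q i.
pose f w := (map_mpoly intr alpha).@[heron_arg rho (qw^~ w)].
have -> : (map_mpoly intr alpha).@[heron_arg rho q] = f (q j).
  congr (_.@[heron_arg _ _]); apply/funext => i; rewrite /qw.
  by case: eqP => [->//|_]; case: eqP => [->|//]; rewrite mulfK.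
have [g [g_inj gc]] := unit_circle_infinite R.
apply: (@laurent_eq0 _ f g) => //.
  apply: laurent_meval; apply: (@laurent_heron_arg _ _ (fun=> rho)).
  - exact: laurent_cst.
  - move=> i; rewrite /qw; case: eqP => _; first exact: laurent_id.
    case: eqP => _; last exact: laurent_cst.
    by apply: laurentM; [exact: laurent_cst|exact: laurent_inv].
  - move=> i; rewrite /qw; case: eqP => _; first exact: laurent_inv.
    case: eqP => _; last exact: laurent_cst.
    under [X in laurent X]funext do rewrite invfM invrK.
    by apply: laurentM; [exact: laurent_cst|exact: laurent_id].
move=> l; have [gl gl0] := gc l; split=> //; apply: IHk.
- move=> i; rewrite /qw; case: (i =P j) => // _; case: (i =P ord_max) => // _.
  by rewrite !mulf_neq0 ?invr_neq0.
- transitivity (\prod_i q i) => //; clear q1.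
  rewrite (bigD1 j) // [RHS](bigD1 j) //= (bigD1 ord_max) 1?eq_sym //=.
  rewrite [in RHS](bigD1 ord_max) 1?eq_sym //= !mulrA; congr (_ * _).
    by rewrite /qw eqxx [ord_max == j]eq_sym (negbTE jmax) eqxx; field.
  by apply: eq_bigr => i /andP[ij im]; rewrite /qw (negbTE ij) (negbTE im).
- move=> i ki; rewrite /qw; case: eqP => // /eqP ij; case: eqP => [im|_].
    by move: ki; rewrite im /=; lia.
  by apply: qc; move: ij; rewrite -val_eqE /=; lia.
Qed.

(** * Evaluation in u_2 and the elementary symmetric functions *)

Definition vcons (A : Type) (n : nat) (u : A) (x : 'I_n -> A) (i : 'I_n.+1) : A :=
  if unlift ord0 i is Some j then x j else u.

Lemma tnth_vcons (A : Type) (n : nat) (u : A) (x : 'I_n -> A) :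
  tnth [tuple of u :: [tuple x i | i < n]] =1 vcons u x.
Proof.
move=> i; rewrite /vcons; case: unliftP => [j ->|->]; last by rewrite tnth0.
by rewrite tnthS tnth_mktuple.
Qed.

Lemma meval_intr_comp (A : comNzRingType) k n (p : {mpoly int[n]})
    (t : n.-tuple {mpoly int[k]}) (v : 'I_k -> A) :
  (map_mpoly intr (p \mPo t)).@[v]
  = (map_mpoly intr p).@[fun i => (map_mpoly intr (tnth t i)).@[v]].
Proof.
apply: (mpoly_rmorph_ext (f := meval v \o map_mpoly intr \o comp_mpoly t)
  (g := meval (fun i => (map_mpoly intr (tnth t i)).@[v]) \o map_mpoly intr)) => i /=.
by rewrite comp_mpolyXU -tnth_nth map_mpolyX mevalXU.
Qed.

Lemma map_mesym (A : comNzRingType) n k :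
  map_mpoly intr (mesym n int k) = mesym n A k.
Proof.
rewrite !mesymE rmorph_sum; apply: eq_bigr => h _; exact: map_mpolyX.
Qed.

Lemma meval_u2_sigma (A : comNzRingType) n (alpha beta : {mpoly int[n.+1]})
    (u : A) (x : 'I_n -> A) : expressed_in_u2_sigma alpha beta ->
  (map_mpoly intr beta).@[vcons u (fun i => (mesym n A i.+1).@[x])]
  = (map_mpoly intr alpha).@[vcons (- 4 * u) x].
Proof.
move=> /(congr1 (fun p => (map_mpoly intr p).@[vcons u x])).
rewrite !meval_intr_comp.
have X0 : (map_mpoly intr ('X_ord0 : {mpoly int[n.+1]})).@[vcons u x] = u.
  by rewrite map_mpolyX mevalXU /vcons unlift_none.
have XS j : (map_mpoly intr ('X_(lift ord0 j) : {mpoly int[n.+1]})).@[vcons u x] = x j.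
  by rewrite map_mpolyX mevalXU /vcons liftK.
rewrite (meval_eq (v2 := vcons u (fun i => (mesym n A i.+1).@[x]))); last first.
  move=> i; rewrite tnth_vcons /vcons; case: unliftP => [j _|_]; last exact: X0.
  rewrite meval_intr_comp map_mesym; apply: meval_eq => l.
  by rewrite tnth_mktuple XS.
move->; apply: meval_eq => i; rewrite tnth_vcons /vcons.
case: unliftP => [j _|_]; first exact: XS.
rewrite rmorphM rmorphM /= X0; congr (_ * _).
by rewrite !rmorphN !rmorph_nat.
Qed.

(** * Polygon data of a parametrized point *)

Section PellToPolygon.
Variables (F : numClosedFieldType) (m : nat).
Hypothesis hm : (1 <= m)%N.
Let n := (2 * m).+1.

(* With z = - s / (rho (s - 1)^2) one has 1 - 4 rho z = ((s + 1) / (s - 1))^2, so the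
   factors D +- z C sqrt(1 - 4 rho z) of D^2 - z^2 (1 - 4 rho z) C^2 become rational
   functions of s, exchanged by s |-> 1/s; their numerators have the roots q_i, 1/q_i. *)
Lemma pell_polygon (D C : {poly F}) (rho : F) : rho != 0 ->
    pell_params m D (1 - (4 * rho) *: 'X) C ->
  exists q : 'I_n -> F, [/\ forall i, q i != 0, \prod_i q i = 1,
    rho * \sum_i (q i - (q i)^-1) = 2 * C`_0 &
    forall k, (k <= n)%N -> (pell_poly D (1 - (4 * rho) *: 'X) C)`_k
      = (-1) ^+ k * (mesym n F k).@[fun i => rho * (2 - q i - (q i)^-1)]].
Proof.
move=> rho0 [D0 sD sB sC].
(* Off s = 1 one has z = Z / Y^2. Thus [A] and [E] are the polynomials equal there to (s - 1)^n
   times D(z) and z C(z) (s + 1) / (s - 1). *)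
pose Y : {poly F} := 'X - 1; pose Z : {poly F} := (- rho^-1) *: 'X.
pose A := \sum_(j < m.+1) D`_j *: (Z ^+ j * Y ^+ (n - 2 * j)).
pose E := \sum_(k < m) C`_k *: (Z ^+ k.+1 * Y ^+ (n - 2 * k - 3) * ('X + 1)).
pose z (s : F) := - s / (rho * (s - 1) ^+ 2).
have Ys (s : F) : Y.[s] = s - 1 by rewrite /Y hornerD hornerN hornerX hornerC.
have Zs (s : F) : s != 1 -> Z.[s] = z s * (s - 1) ^+ 2.
  move=> s1; have s10 : s - 1 != 0 by rewrite subr_eq0.
  by rewrite /Z /z hornerZ hornerX; field; rewrite rho0 s10.
have As (s : F) : s != 1 -> A.[s] = (s - 1) ^+ n * D.[z s].
  move=> s1; rewrite /A horner_sum (horner_coef_wide _ sD) mulr_sumr.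
  apply: eq_bigr => j _; rewrite hornerZ hornerM !horner_exp Ys Zs //.
  have -> : (s - 1) ^+ n = (s - 1) ^+ 2 ^+ j * (s - 1) ^+ (n - 2 * j).
    by rewrite -exprM -exprD; congr (_ ^+ _); have := ltn_ord j; rewrite /n; lia.
  by rewrite exprMn; ring.
have Es (s : F) : s != 1 -> E.[s] = (s - 1) ^+ (n - 1) * (z s * C.[z s]) * (s + 1).
  move=> s1; rewrite /E horner_sum (horner_coef_wide _ sC) !(mulr_sumr, mulr_suml).
  apply: eq_bigr => k _; rewrite hornerZ !hornerM !horner_exp Ys Zs // hornerD hornerX hornerC.
  have -> : (s - 1) ^+ (n - 1) = (s - 1) ^+ 2 ^+ k.+1 * (s - 1) ^+ (n - 2 * k - 3).
    by rewrite -exprM -exprD; congr (_ ^+ _); have := ltn_ord k; rewrite /n; lia.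
  by rewrite exprMn [z s ^+ k.+1]exprS /=; ring.
have szY k : size (Y ^+ k) = k.+1 by rewrite /Y -polyC1 size_exp_XsubC.
have szZ k : (size (Z ^+ k) <= k.+1)%N.
  rewrite /Z exprZn (leq_trans (size_scale_leq _ _)) // size_polyXn //.
(* As D_0 = 1, the term Y^n of [A] is monic of degree n; all other terms of [A] and [E] have lower
   degree. *)
have sA : (size (A - Y ^+ n)%R <= n)%N.
  rewrite /A big_ord_recl D0 scale1r expr0 mul1r muln0 subn0 addrC addKr.
  rewrite (leq_trans (size_sum _ _ _)) //; apply/bigmax_leqP => j _.
  rewrite (leq_trans (size_scale_leq _ _)) // (leq_trans (size_polyMleq _ _)) //.
  have := szZ (lift ord0 j); rewrite szY lift0 /n; have := ltn_ord j; lia.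
have sE k : (k < m)%N -> (size (Z ^+ k.+1 * Y ^+ (n - 2 * k - 3) * ('X + 1))%R <= n - k)%N.
  move=> km; rewrite (leq_trans (size_polyMleq _ _)) //.
  have := size_polyMleq (Z ^+ k.+1) (Y ^+ (n - 2 * k - 3)).
  by have := szZ k.+1; rewrite szY -polyC1 size_XaddC /n; lia.
have sEn : (size E <= n)%N.
  rewrite (leq_trans (size_sum _ _ _)) //; apply/bigmax_leqP => k _.
  rewrite (leq_trans (size_scale_leq _ _)) // (leq_trans (sE _ _)) // leq_subr //.
have monicD (P : {poly F}) : (size P <= n)%N ->
    A + P \is monic /\ size (A + P) = n.+1.
  move=> sP; have -> : A + P = Y ^+ n + ((A - Y ^+ n) + P).
    by rewrite addrA addrCA subrr addr0.
  have sH : (size ((A - Y ^+ n) + P)%R < size (Y ^+ n))%N.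
    by rewrite szY ltnS (leq_trans (size_polyD _ _)) // geq_max sA.
  rewrite size_polyDl // szY; split=> //.
  by rewrite monicE lead_coefDl // -monicE monic_exp // /Y -polyC1 monicXsubC.
have [mG sG] := monicD E sEn.
have [cs] := closed_field_poly_normal (A + E); rewrite (monicP mG) scale1r => Gcs.
have scs : size cs = n.
  by apply: succn_inj; rewrite -sG Gcs size_prod_XsubC.
pose t : n.-tuple F := tcast scs (in_tuple cs).
have tcs : tval t = cs by rewrite val_tcast.
pose q i := tnth t i.
have GE : A + E = \prod_(i < n) ('X - (q i)%:P).
  by rewrite Gcs -tcs big_tuple.
have sgn : (-1) ^+ n = -1 :> F by rewrite -signr_odd /n /= oddM.
(* Evaluate at s = 0, where z = 0: the value of A + E is (-1)^n = -1, n being odd. *)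
have q1 : \prod_i q i = 1.
  have : (A + E).[0] = -1.
    have n01 : (0 : F) != 1 by rewrite eq_sym oner_neq0.
    have z0 : z 0 = 0 by rewrite /z oppr0 mul0r.
    by rewrite hornerD As // Es // z0 mul0r mulr0 mul0r addr0 sub0r sgn horner_coef0 D0 mulr1.
  rewrite GE horner_prod; under eq_bigr do rewrite hornerXsubC sub0r.
  by rewrite prodrN card_ord sgn mulN1r => /oppr_inj.
have q0 i : q i != 0.
  by apply: contra_eq_neq q1 => qi; rewrite (bigD1 i) //= qi mul0r eq_sym oner_neq0.
(* Replacing s by 1/s fixes z and yields A - E = - s^n (A + E)(1/s), so the roots are inverted.
   Comparing at s = 2, 3, ... avoids the exceptional values 0 and 1. *)
have GV : A - E = \prod_(i < n) ('X - (q i)^-1%:P).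
  apply/eqP; rewrite -subr_eq0; apply/eqP.
  apply: (@poly_eq0_inj_roots _ (fun l => l.+2%:R)).
    by move=> a b /eqP; rewrite eqr_nat !eqSS => /eqP.
  move=> l; set s : F := l.+2%:R.
  have s0 : s != 0 by rewrite pnatr_eq0.
  have s1 : s != 1 by rewrite pnatr_eq1.
  clearbody s.
  have s10 : s - 1 != 0 by rewrite subr_eq0.
  have s1V : s^-1 != 1 by rewrite invr_eq1.
  have zV : z s^-1 = z s.
    by rewrite /z; field; rewrite rho0 s0 s10 mulN1r subr_eq0 eq_sym s1.
  have eV : s^-1 - 1 = - (s - 1) / s by field.
  rewrite /root hornerD hornerN subr_eq0. rewrite hornerD hornerN As // Es //.
  have -> : (\prod_(i < n) ('X - (q i)^-1%:P)).[s] = - s ^+ n * (A + E).[s^-1].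
    rewrite GE !horner_prod.
    have -> : - s ^+ n = \prod_(i < n) (- s * (q i)^-1).
      by rewrite big_split /= prodfV q1 invr1 mulr1 prodr_const card_ord exprNn sgn mulN1r.
    rewrite -big_split /=; apply: eq_bigr => i _; rewrite !hornerXsubC.
    by have := q0 i => qi; field; rewrite ?s0 ?qi.
  rewrite hornerD As // Es // zV eV /n subn1 /= !exprSr !expr_div_n.
  have -> : (- (s - 1)) ^+ (2 * m) = (s - 1) ^+ (2 * m) by rewrite !exprM sqrrN.
  have sm0 : s ^+ (2 * m) != 0 by rewrite expf_neq0.
  by apply/eqP; field; rewrite s0.
exists q; split=> //.
  (* Only the term k = 0 of [E] reaches degree n - 1. Twice this coefficient is the difference of
     those of A + E and A - E, that is - sum_i (q_i - 1/q_i). *)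
  have cE : E`_(n - 1) = - rho^-1 * C`_0.
    rewrite /E (bigD1 (Ordinal hm)) //= coefD coef_sum big1 ?addr0 => [|k k0]; last first.
      rewrite coefZ [X in _ * X]nth_default ?mulr0 // (leq_trans (sE _ _)) // leq_sub2l //.
      by move: k0; rewrite -val_eqE /= lt0n.
    rewrite coefZ expr1 muln0 subn0 mulrC; congr (_ * _).
    rewrite /Z -!scalerAl coefZ -[RHS]mulr1; congr (_ * _).
    have mX : ('X * Y ^+ (n - 3) * ('X + 1) : {poly F}) \is monic.
      by rewrite !(monicX, rpredM) // ?monic_exp // /Y -polyC1 ?monicXsubC ?monicXaddC.
    have sX : size ('X * Y ^+ (n - 3) * ('X + 1))%R = n.
      rewrite size_monicM ?monicMl ?monicX ?monic_exp // /Y -?polyC1 ?monicXsubC //; last first.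
        by rewrite -size_poly_eq0 size_XaddC.
      rewrite size_XaddC size_monicM ?monicX //; last first.
        by rewrite -size_poly_eq0 size_exp_XsubC.
      rewrite size_polyX size_exp_XsubC /n; move: hm; lia.
    by move/monicP: mX; rewrite lead_coefE sX subn1.
  have cq (p : 'I_n -> F) : (\prod_(i < n) ('X - (p i)%:P))`_(n - 1) = - \sum_i p i.
    have := mroots_sum [tuple p i | i < n]; rewrite !big_tuple.
    under eq_bigr do rewrite tnth_mktuple.
    move=> ->; rewrite opprK subn1 /=; congr (nth _ (polyseq _) _).
    by apply: eq_bigr => i _; rewrite tnth_mktuple.
  have := cq q; rewrite -GE; have := cq (fun i => (q i)^-1); rewrite -GV.
  rewrite coefD coefN coefD cE => e1 e2; rewrite sumrB.
  rewrite -[\sum_i q i]opprK -e2 -[X in _ - X]opprK -e1.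
  by field.
pose x i := rho * (2 - q i - (q i)^-1).
pose xt := [tuple x i | i < n]; pose P := \prod_(c <- xt) ('X - c%:P).
pose S := pell_poly D (1 - (4 * rho) *: 'X) C.
pose S' := \poly_(k < n.+1) P`_(n - k).
have sP : size P = n.+1 by rewrite size_prod_XsubC size_tuple.
have S'E w : w != 0 -> S'.[w] = \prod_(i < n) (1 - x i * w).
  move=> w0; transitivity (w ^+ n * P.[w^-1]).
    rewrite horner_poly (horner_coef_wide _ (eq_leq sP)) mulr_sumr.
    rewrite (reindex_inj rev_ord_inj) /=; apply: eq_bigr => k _.
    rewrite subSS subKn -1?ltnS // mulrCA; congr (_ * _).
    have kn : (k <= n)%N by rewrite -ltnS.
    have -> : w ^+ n = w ^+ (n - k) * w ^+ k by rewrite -exprD subnK.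
    by rewrite exprVn mulfK // expf_neq0.
  rewrite /P horner_prod big_tuple -[n in w ^+ n]card_ord -prodr_const -big_split /=.
  apply: eq_bigr => i _; rewrite tnth_mktuple hornerXsubC mulrBr mulfV //.
  by rewrite [w * _]mulrC.
(* [S'] is the reversal of [P], that is prod_i (1 - x_i z). It agrees with [S] at all z(s), s = 2,
   3, ...: both become (A + E)(A - E) after multiplication by (s - 1)^(2n), since (s - q)(s - 1/q) =
   (s - 1)^2 (1 - x z). *)
suff eS : S = S'.
  move=> k kn; rewrite -/S eS coef_poly ltnS kn.
  have kn' : (k < n.+1)%N by [].
  have := mroots_coeff xt (Ordinal kn'); rewrite -/P /= => ->; congr (_ * _).
  by apply: meval_eq => i; rewrite tnth_mktuple.
apply/eqP; rewrite -subr_eq0; apply/eqP.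
apply: (@poly_eq0_inj_roots _ (fun l => z (l.+2%:R))).
  (* z takes equal values at a and b only if a = b or a b = 1, and the latter is excluded for
     integers at least 2. *)
  move=> a b /eqP; rewrite /z.
  have nz (l : nat) : rho * (l.+2%:R - 1) ^+ 2 != 0.
    by rewrite mulf_neq0 // expf_neq0 // subr_eq0 pnatr_eq1.
  rewrite eqr_div ?nz // -subr_eq0.
  have -> : - a.+2%:R * (rho * (b.+2%:R - 1) ^+ 2) - - b.+2%:R * (rho * (a.+2%:R - 1) ^+ 2)
     = rho * ((a.+2%:R - b.+2%:R) * ((a.+2 * b.+2)%:R - 1)) by rewrite natrM; ring.
  rewrite !mulf_eq0 (negbTE rho0) !subr_eq0 pnatr_eq1 eqr_nat orFb.
  by case/orP => [/eqP [] //|]; rewrite muln_eq1.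
move=> l; set s : F := l.+2%:R.
have s0 : s != 0 by rewrite pnatr_eq0.
have s1 : s != 1 by rewrite pnatr_eq1.
clearbody s; have s10 : s - 1 != 0 by rewrite subr_eq0.
have zs0 : z s != 0 by rewrite /z mulf_neq0 ?oppr_eq0 // invr_neq0 // mulf_neq0 // expf_neq0.
rewrite /root hornerD hornerN subr_eq0 S'E //; apply/eqP.
have y0 : ((s - 1) ^+ 2) ^+ n != 0 by rewrite !expf_neq0.
apply: (mulfI y0); transitivity ((A + E).[s] * (A - E).[s]).
  have -> : S.[z s] = D.[z s] ^+ 2 - z s ^+ 2 * ((1 - 4 * rho * z s) * C.[z s] ^+ 2).
    by rewrite /S /pell_poly !hornerE /=; ring.
  rewrite hornerD [in RHS]hornerD hornerN As // Es //.
  have -> : 1 - 4 * rho * z s = ((s + 1) / (s - 1)) ^+ 2.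
    by rewrite /z; field; rewrite rho0 s10.
  have -> : (s - 1) ^+ n = (s - 1) * (s - 1) ^+ (n - 1) by rewrite -exprS /n subn1.
  have -> : (s - 1) ^+ 2 ^+ n = ((s - 1) * (s - 1) ^+ (n - 1)) ^+ 2.
    by rewrite -exprS /n subn1 -!exprM mulnC.
  by field.
rewrite GE GV !horner_prod -big_split /= -[n in _ ^+ n]card_ord -prodr_const -big_split /=.
apply: eq_bigr => i _; rewrite !hornerXsubC /x /z.
by have := q0 i => qi; field; rewrite qi rho0 s10.
Qed.

End PellToPolygon.

Lemma poly_size2 (A : nzRingType) (B : {poly A}) :
  (size B <= 2)%N -> B = (B`_0)%:P + B`_1 *: 'X.
Proof.
move=> sB; apply/polyP => i; rewrite coefD coefC coefZ coefX.
case: i => [|[|i]] /=; rewrite ?mulr0 ?mulr1 ?addr0 ?add0r //.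
by rewrite nth_default // (leq_trans sB).
Qed.

Lemma tnth_pell_point (A : nzRingType) m (D B C : {poly A}) i :
  tnth (pell_point m D B C) i
  = vcons (B`_0 * C`_0 ^+ 2) (fun j => (-1) ^+ j.+1 * (pell_poly D B C)`_j.+1) i.
Proof. exact: tnth_vcons. Qed.

Lemma laurent_eq0_generic (F : numFieldType) (f : F -> F) (bad : {poly F}) :
    laurent f -> bad != 0 ->
    (forall w, w != 0 -> bad.[w] != 0 -> f w = 0) ->
  forall w, w != 0 -> f w = 0.
Proof.
move=> [Q [k hQ]] bad0 fbad w w0; rewrite hQ //.
suff -> : Q = 0 by rewrite horner0 mul0r.
apply/eqP; have /eqP : Q * (bad * 'X) = 0.
  apply: (@poly_eq0_inj_roots _ (fun l => l%:R)).
    by move=> a b /eqP; rewrite eqr_nat => /eqP.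
  move=> l; rewrite /root !hornerM hornerX !mulf_eq0.
  have [//|x0] := eqVneq (l%:R : F) 0; first by rewrite !orbT.
  have [//|b0] := eqVneq bad.[l%:R] 0; first by rewrite !orbT.
  rewrite !orbF; have /eqP := fbad _ x0 b0.
  by rewrite hQ // mulf_eq0 invr_eq0 (negbTE (expf_neq0 _ x0)) orbF.
by rewrite !mulf_eq0 (negbTE bad0) polyX_eq0 !orbF.
Qed.

(** * Vanishing at every parametrized point *)

Section HeronOnPell.
Variables (R : realType) (m : nat).
Hypothesis hm : (1 <= m)%N.
Variables alpha beta : {mpoly int[(2 * m).+2]}.
Hypothesis halpha : forall v : 'I_(2 * m).+1 -> R * R, cyclic_polygon v ->
  (map_mpoly intr alpha).@[
    tnth [tuple of 16 * signed_area v ^+ 2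
                   :: [tuple side_length v i ^+ 2 | i < (2 * m).+1]]] = 0.
Hypothesis hbeta : @expressed_in_u2_sigma (2 * m).+1 alpha beta.

(** A square root of B_0 moves into C, leaving B = 1 - 4 rho z with rho nonzero because B_1 is. The
    polygon found has 16 K^2 = - (2 b C_0)^2 = - 4 u_2. *)
Lemma heron_on_generic_pell (D B C : {poly R[i]}) :
    pell_params m D B C -> B`_0 != 0 -> B`_1 != 0 ->
  (map_mpoly intr beta).@[tnth (pell_point m D B C)] = 0.
Proof.
move=> [D0 sD sB sC] b0 b1; pose b := sqrtC B`_0; pose rho := - (B`_1 / (4 * B`_0)).
have bb : b ^+ 2 = B`_0 by rewrite sqrtCK.
have rho0 : rho != 0 by rewrite oppr_eq0 mulf_neq0 // invr_neq0 // mulf_neq0 // pnatr_eq0.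
have eB : B = B`_0 *: (1 - (4 * rho) *: 'X).
  rewrite {1}(poly_size2 sB) scalerBr scalerA alg_polyC; congr (_ + _).
  by rewrite -scaleNr; congr (_ *: _); rewrite /rho; field.
have eS : pell_poly D B C = pell_poly D (1 - (4 * rho) *: 'X) (b *: C).
  rewrite /pell_poly exprZn bb {1}eB; congr (_ - _ * _).
  by rewrite -scalerAl -scalerAr.
have [|q [q0 q1 eq eq2]] := @pell_polygon _ m hm D (b *: C) rho rho0.
  split=> //; last exact: leq_trans (size_scale_leq _ _) sC.
  rewrite (leq_trans (size_polyD _ _)) // geq_max size_poly1 size_polyN /=.
  by rewrite (leq_trans (size_scale_leq _ _)) // size_polyX.
pose x i := rho * (2 - q i - (q i)^-1).
rewrite (meval_eq (v2 := vcons (B`_0 * C`_0 ^+ 2)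
    (fun i => (mesym (2 * m).+1 R[i] i.+1).@[x]))); last first.
  move=> i; rewrite tnth_pell_point /vcons; case: unliftP => // j _.
  by rewrite eS eq2 // mulrA -expr2 sqrr_sign mul1r.
rewrite (meval_u2_sigma _ _ hbeta) -[RHS](heron_complex halpha rho0 q0 q1).
apply: meval_eq => i; rewrite /vcons /heron_arg; case: unliftP => // _.
by rewrite eq coefZ exprMn exprMn bb; ring.
Qed.

(** Move B along the line B + (w - 1)(1 + z), which leaves the generic case for at most two values
    of w. The shift places the given B at w = 1, since Laurent functions are not controlled at 0. *)
Lemma heron_on_pell (D B C : {poly R[i]}) : pell_params m D B C ->
  (map_mpoly intr beta).@[tnth (pell_point m D B C)] = 0.
Proof.
move=> [D0 sD sB sC].
pose Bw w : {poly R[i]} := B + (w - 1) *: (1 + 'X).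
have Bw0 w : (Bw w)`_0 = B`_0 + w - 1.
  by rewrite coefD coefZ coefD coef1 coefX addr0 mulr1 addrA.
have Bw1 w : (Bw w)`_1 = B`_1 + w - 1.
  by rewrite coefD coefZ coefD coef1 coefX add0r mulr1 addrA.
pose f w := (map_mpoly intr beta).@[tnth (pell_point m D (Bw w) C)].
have -> : (map_mpoly intr beta).@[tnth (pell_point m D B C)] = f 1.
  by rewrite /f /Bw subrr scale0r addr0.
pose bad : {poly R[i]} := ('X - (1 - B`_0)%:P) * ('X - (1 - B`_1)%:P).
apply: (@laurent_eq0_generic _ f bad); last exact: oner_neq0.
- apply: (@laurent_meval _ _ _ (fun i w => tnth (pell_point m D (Bw w) C) i)) => i.
  under [X in laurent X]funext do rewrite tnth_pell_point /vcons.
  have lin (a c : R[i]) : laurent (fun w => a + (w - 1) * c).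
    apply: laurentD; first exact: laurent_cst.
    apply: laurentM; last exact: laurent_cst.
    by apply: laurentD; [exact: laurent_id | exact: laurent_cst].
  case: unliftP => [j _|_].
    apply: laurentM; first exact: laurent_cst.
    pose b := ('X^2 * ((1 + 'X) * C ^+ 2))`_j.+1.
    have e w : (pell_poly D (Bw w) C)`_j.+1 =
        (pell_poly D B C)`_j.+1 + (w - 1) * - b.
      rewrite /b /pell_poly /Bw mulrN -coefZ -coefN -coefD; congr (_`__).
      by rewrite mulrDl mulrDr opprD addrA -!scalerAl -scalerAr.
    by under [X in laurent X]funext do rewrite e; exact: lin.
  apply: laurentM; last exact: laurent_cst.
  by under [X in laurent X]funext do rewrite Bw0 -addrA -[_ - 1]mulr1; exact: lin.
- by rewrite mulf_neq0 // polyXsubC_eq0.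
move=> w w0; rewrite hornerM !hornerXsubC mulf_eq0 negb_or !subr_eq0 => /andP[h0 h1].
apply: heron_on_generic_pell.
- split=> //; rewrite (leq_trans (size_polyD _ _)) // geq_max sB.
  by rewrite (leq_trans (size_scale_leq _ _)) // addrC -polyC1 size_XaddC.
- by rewrite Bw0 -addrA addrC -[B`_0]opprK subr_eq0 subr_eq addrC.
- by rewrite Bw1 -addrA addrC -[B`_1]opprK subr_eq0 subr_eq addrC.
Qed.

End HeronOnPell.

(** * The prime factor of the Heron polynomial *)

Section FourScaling.
Variable n : nat.

Definition scale4 : {mpoly int[n.+1]} -> {mpoly int[n.+1]} :=
  comp_mpoly [tuple of - 4 * 'X_ord0 :: [tuple 'X_(lift ord0 i) : {mpoly int[n.+1]} | i < n]].

HB.instance Definition _ := GRing.RMorphism.on scale4.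

(** Substitutes for the inverse of u_2 |-> - 4 u_2, which does not exist over the integers. The
    property passes to sums and products; among constants and variables only the first variable
    costs a factor 4. *)
Lemma scale4_up_to_power (w : {mpoly int[n.+1]}) :
  exists N w', scale4 w' = (4 ^+ N) *: w.
Proof.
pose P w := exists N w', scale4 w' = (4 ^+ N) *: w.
have PD w1 w2 : P w1 -> P w2 -> P (w1 + w2).
  move=> [N1 [v1 e1]] [N2 [v2 e2]].
  exists (N1 + N2)%N, (4 ^+ N2 *: v1 + 4 ^+ N1 *: v2).
  rewrite /scale4 linearD !linearZ /= -/scale4 e1 e2 !scalerA scalerDr -!exprD.
  by rewrite [(N2 + N1)%N]addnC.
have PM w1 w2 : P w1 -> P w2 -> P (w1 * w2).
  move=> [N1 [v1 e1]] [N2 [v2 e2]]; exists (N1 + N2)%N, (v1 * v2).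
  by rewrite rmorphM /= e1 e2 exprD -scalerAl -scalerAr scalerA.
have PC c : P c%:MP by exists 0%N, c%:MP; rewrite /scale4 comp_mpolyC expr0 scale1r.
have PX i : P 'X_i.
  case: (unliftP ord0 i) => [j ->|->].
    exists 0%N, 'X_(lift ord0 j); rewrite /scale4 comp_mpolyXU expr0 scale1r.
    by rewrite -tnth_nth tnth_vcons /vcons liftK.
  exists 1%N, (- 'X_ord0); rewrite /scale4 linearN /= comp_mpolyXU expr1.
  by rewrite -tnth_nth tnth_vcons /vcons unlift_none mulNr opprK -mul_mpolyC mpolyC_nat.
rewrite -/(P w); elim/mpolyind: w => [|c m p _ _ Pp]; first by rewrite -mpolyC0; exact: PC.
apply: PD => //; rewrite -mul_mpolyC; apply: (PM) => //; rewrite mpolyXE_id.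
elim/big_ind: _ => [|w1 w2|i _]; [by rewrite -mpolyC1; exact: PC | exact: (PM) |].
elim: (m i) => [|k IHk]; first by rewrite expr0 -mpolyC1; exact: PC.
by rewrite exprS; exact: PM.
Qed.

Lemma scale4_inj : injective scale4.
Proof.
move=> w1 w2; move/eqP; rewrite -subr_eq0 -rmorphB /= => /eqP e.
apply/eqP; rewrite -subr_eq0; apply/eqP; move: (w1 - w2) e => w {w1 w2} e.
have X m : scale4 'X_[m] = (- 4) ^+ m ord0 *: 'X_[m].
  rewrite /scale4 comp_mpolyX (mpolyXE_id _ m) !big_ord_recl.
  rewrite tnth0 exprMn -!mul_mpolyC rmorphXn /= rmorphN /= mpolyC_nat !mulrA.
  congr (_ * _); apply: eq_bigr => i _.
  by rewrite tnthS tnth_mktuple.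
apply/mpolyP => m; rewrite mcoeff0.
have : (scale4 w)@_m = (- 4) ^+ m ord0 * w@_m.
  rewrite {1}[w]mpolyE rmorph_sum /= raddf_sum /= [w in RHS]mpolyE raddf_sum mulr_sumr.
  apply: eq_bigr => k _; rewrite /scale4 linearZ /= -/scale4 X !mcoeffZ mcoeffX.
  by case: eqP => [->|_]; rewrite ?mulr0 // !mulr1 mulrC.
by rewrite e mcoeff0 => /esym/eqP; rewrite mulf_eq0 expf_eq0 /= andbF /= => /eqP.
Qed.

End FourScaling.

(** The x_i are the roots of the monic polynomial with the prescribed signed coefficients. *)
Lemma elementary_symmetric_onto (F : closedFieldType) n (y : 'I_n -> F) :
  exists x : 'I_n -> F, forall i : 'I_n, (mesym n F i.+1).@[x] = y i.
Proof.
pose c (k : nat) : F := if insub k is Some i then (-1) ^+ k.+1 * y i else 0.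
pose P : {poly F} := 'X^n + \poly_(k < n) c (n - k.+1)%N.
have sQ : (size (\poly_(k < n) c (n - k.+1)%N) < size ('X^n : {poly F}))%N.
  by rewrite size_polyXn ltnS size_poly.
have mP : P \is monic by rewrite monicE lead_coefDl // lead_coefXn.
have [cs] := closed_field_poly_normal P; rewrite (monicP mP) scale1r => Pcs.
have scs : size cs = n.
  by apply: succn_inj; rewrite -(size_prod_XsubC cs idfun) -Pcs size_polyDl // size_polyXn.
pose t : n.-tuple F := tcast scs (in_tuple cs).
have tcs : tval t = cs by rewrite val_tcast.
exists (tnth t) => i; have iS : (i.+1 < n.+1)%N by rewrite ltnS.
have := mroots_coeff t (Ordinal iS); rewrite tcs -Pcs /=.
rewrite coefD coefXn ltn_eqF ?add0r; last first.
  by have := ltn_ord i; lia.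
rewrite coef_poly ifT; last first.
  by have := ltn_ord i; lia.
have -> : (n - (n - i.+1).+1 = i)%N by have := ltn_ord i; lia.
rewrite /c; case: insubP => [j _ ji|]; last by rewrite ltn_ord.
have -> : j = i by apply/val_inj.
by move=> e; apply: (@mulfI _ ((-1) ^+ i.+1)); rewrite ?signr_eq0 // e.
Qed.

Lemma meval_intr_scale4 (n : nat) (F : numFieldType) (k : nat) (w : {mpoly int[n]}) v :
  (map_mpoly intr (4 ^+ k *: w)).@[v] = (4 : F) ^+ k * (map_mpoly intr w).@[v].
Proof. by rewrite map_mpolyZ mevalZ rmorphXn /= rmorph_nat. Qed.

(* A factorization of beta becomes one of alpha, up to a power of 4, after substituting
   the elementary symmetric polynomials. *)
Lemma heron_factor_nowhere_zero (F : numClosedFieldType) n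
    (alpha beta q r : {mpoly int[n.+1]}) :
    prime_elt alpha -> expressed_in_u2_sigma alpha beta -> beta = q * r ->
  (forall y : 'I_n.+1 -> F, (map_mpoly intr q).@[y] != 0) \/
  (forall y : 'I_n.+1 -> F, (map_mpoly intr r).@[y] != 0).
Proof.
move=> [alpha0 _ alphaP] hbeta eqr.
pose sym : {mpoly int[n.+1]} -> {mpoly int[n.+1]} := comp_mpoly [tuple of 'X_ord0
  :: [tuple mesym n int i.+1 \mPo [tuple 'X_(lift ord0 i) : {mpoly int[n.+1]} | i < n]
     | i < n]].
have hb : sym beta = scale4 alpha := hbeta.
have symM a b : sym (a * b) = sym a * sym b by rewrite /sym rmorphM.
have [N [q' eq]] := scale4_up_to_power (sym q).
have [N' [r' er]] := scale4_up_to_power (sym r).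
have four0 k : ((4 ^+ k)%:MP : {mpoly int[n.+1]}) != 0.
  by rewrite mpolyC_eq0 expf_neq0.
have qr' : q' * r' = (4 ^+ (N + N')) *: alpha.
  apply: scale4_inj; rewrite rmorphM /= eq er -scalerAl -scalerAr -symM -eqr hb.
  by rewrite scalerA /scale4 comp_mpolyZ exprD [4 ^+ N * _]mulrC.
(* If alpha divides one factor, the other one divides a power of 4. *)
have nz (a a' b b' k : {mpoly int[n.+1]}) M M' : scale4 a' = 4 ^+ M *: sym a ->
    scale4 b' = 4 ^+ M' *: sym b -> a' * b' = (4 ^+ (M + M')) *: alpha ->
    a' = alpha * k -> forall y : 'I_n.+1 -> F, (map_mpoly intr b).@[y] != 0.
  move=> ea eb eab ek y.
  have kb : k * b' = (4 ^+ (M + M'))%:MP.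
    by apply: (mulfI alpha0); rewrite mulrA -ek eab -mul_mpolyC mulrC.
  (* Any point y has the form (u_2, sigma(x)), so nonvanishing can be tested after substitution,
     where the factor divides a power of 4. *)
  have [x xy] := elementary_symmetric_onto (fun i => y (lift ord0 i)).
  have sb : (map_mpoly intr (sym b)).@[vcons (y ord0) x] = (map_mpoly intr b).@[y].
    rewrite meval_intr_comp; apply: meval_eq => i; rewrite tnth_vcons /vcons.
    case: unliftP => [j ->|->]; last by rewrite map_mpolyX mevalXU unlift_none.
    rewrite meval_intr_comp map_mesym -xy; apply: meval_eq => l.
    by rewrite tnth_mktuple map_mpolyX mevalXU liftK.
  have s4 w : (map_mpoly intr (scale4 w)).@[vcons (y ord0) x] =
      (map_mpoly intr w).@[vcons (- 4 * y ord0) x].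
    rewrite meval_intr_comp; apply: meval_eq => i; rewrite tnth_vcons /vcons.
    case: unliftP => [j _|_]; first by rewrite map_mpolyX mevalXU liftK.
    by rewrite !rmorphM /= map_mpolyX mevalXU unlift_none !rmorphN !rmorph_nat.
  have := congr1 (fun w => (map_mpoly intr w).@[vcons (y ord0) x]) eb.
  rewrite s4 meval_intr_scale4 sb => eb'.
  have := congr1 (fun w => (map_mpoly intr w).@[vcons (- 4 * y ord0) x]) kb.
  rewrite -alg_mpolyC meval_intr_scale4 !rmorph1 mulr1 !rmorphM /= eb' => e.
  apply: contra_eq_neq e => ->; rewrite !mulr0 eq_sym expf_neq0 //.
  by rewrite pnatr_eq0.
case: (alphaP q' r'); first by exists (4 ^+ (N + N'))%:MP; rewrite qr' -mul_mpolyC mulrC.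
  by move=> [k ek]; right; apply: (nz q q' r r' k N N').
move=> [k ek]; left; apply: (nz r r' q q' k N' N) => //.
by rewrite mulrC qr' addnC.
Qed.

(** Units have no zeros, so some prime factor vanishes at [y0]. This zero rules out one alternative
    of [heron_factor_nowhere_zero]; by the other, the cofactor has no zeros. *)
Lemma prime_factor_of_heron (F : numClosedFieldType) n
    (alpha beta : {mpoly int[n.+1]}) (y0 : 'I_n.+1 -> F) :
    prime_elt alpha -> expressed_in_u2_sigma alpha beta -> beta != 0 ->
    (map_mpoly intr beta).@[y0] = 0 ->
  exists beta0, prime_elt beta0 /\ forall y : 'I_n.+1 -> F,
    (map_mpoly intr beta).@[y] = 0 <-> (map_mpoly intr beta0).@[y] = 0.
Proof.
move=> hal hbeta b0 by0; have [u [s [uu sP eb]]] := factorial_mpoly_int b0.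
have evu y : (map_mpoly intr u).@[y] != 0 :> F.
  rewrite -unitfE; apply: (rmorph_unit (meval y)).
  exact: (rmorph_unit (map_mpoly intr)).
have [p ps py0] : exists2 p, p \in s & (map_mpoly intr p).@[y0] = 0.
  apply: contrapT => nex; move/eqP: by0; apply/negP.
  rewrite eb !rmorphM /= mulf_neq0 // !rmorph_prod prodf_seq_neq0.
  by apply/allP => p ps; apply/negP => /eqP h; apply: nex; exists p.
exists p; split; first exact: sP.
have ebp : beta = p * (u * \prod_(x <- rem p s) x).
  by rewrite eb (perm_big _ (perm_to_rem ps)) /= big_cons mulrCA.
have [np|nr] := heron_factor_nowhere_zero F hal hbeta ebp.
  by have := np y0; rewrite py0 eqxx.
move=> y; rewrite ebp !rmorphM /=; split=> [/eqP|->]; last by rewrite mul0r.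
by rewrite mulf_eq0 -!rmorphM (negbTE (nr y)) orbF => /eqP.
Qed.

(** * Descent to integral points and divisibility *)

Lemma pell_params_map (A B : nzRingType) (f : {rmorphism A -> B}) m D E C :
  pell_params m D E C ->
  pell_params m (map_poly f D) (map_poly f E) (map_poly f C).
Proof.
move=> [D0 sD sE sC]; split.
- by rewrite coef_map D0; exact: (rmorph1 f).
- exact: (leq_trans (size_poly _ _) sD).
- exact: (leq_trans (size_poly _ _) sE).
- exact: (leq_trans (size_poly _ _) sC).
Qed.

Lemma tnth_pell_point_map (A B : nzRingType) (f : {rmorphism A -> B}) m D E C i :
  tnth (pell_point m (map_poly f D) (map_poly f E) (map_poly f C)) i
  = f (tnth (pell_point m D E C) i).
Proof.
rewrite !tnth_pell_point /vcons; case: unliftP => [j _|_].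
  by rewrite -map_pell_poly coef_map rmorphM /= rmorph_sign.
by rewrite !coef_map rmorphM /= rmorphXn.
Qed.

Lemma irreducible_head_poly k (p : {mpoly int[k.+1]}) :
  irreducible_elt p -> irreducible_elt (head_poly p).
Proof.
move=> [pu pI].
have uU (x : {poly {mpoly int[k]}}) :
    x \is a GRing.unit -> unhead_poly x \is a GRing.unit by exact: rmorph_unit.
have hU (x : {mpoly int[k.+1]}) :
    x \is a GRing.unit -> head_poly x \is a GRing.unit by exact: rmorph_unit.
split=> [|q r e]; first by apply: contra pu => /uU; rewrite head_polyK.
have ep : p = unhead_poly q * unhead_poly r.
  by rewrite -[p]head_polyK e; exact: rmorphM.
by case: (pI _ _ ep) => /hU; rewrite unhead_polyK; [left|right].
Qed.

Lemma meval_shift_vars k (c : {mpoly int[k]}) (v : 'I_k.+1 -> int) :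
  (shift_vars c).@[v] = c.@[fun j => v (lift ord0 j)].
Proof.
apply: (mpoly_rmorph_ext (f := meval v \o @shift_vars k)
  (g := meval (fun j => v (lift ord0 j)))) => i /=.
by rewrite shift_varsX !mevalXU.
Qed.

Lemma divides_meval_eq0 (A : comNzRingType) n (p g : {mpoly int[n]}) (v : 'I_n -> A) :
  divides p g -> (map_mpoly intr p).@[v] = 0 -> (map_mpoly intr g).@[v] = 0.
Proof. by move=> [k ->] pv; rewrite rmorphM mevalM pv mul0r. Qed.

(** Without divisibility, eliminating u_2 from [p] and [g] leaves a nonzero polynomial in sigma that
    vanishes at all integral parameters, against [pell_sigma_dense]. *)
Lemma divides_of_vanishing_on_pell m (p g : {mpoly int[(2 * m).+2]}) : (1 <= m)%N ->
    prime_elt p ->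
    (forall D B C : {poly int}, pell_params m D B C -> p.@[tnth (pell_point m D B C)] = 0) ->
    (forall D B C : {poly int}, pell_params m D B C -> g.@[tnth (pell_point m D B C)] = 0) ->
  divides p g.
Proof.
move=> m1 pp hp hg.
have dense c : (forall D B C : {poly int}, pell_params m D B C ->
    (shift_vars c).@[tnth (pell_point m D B C)] = 0) -> c = 0.
  move=> hc; apply: (@pell_sigma_dense m c m1) => D B C hDBC.
  rewrite -[RHS](hc D B C hDBC) meval_shift_vars; apply: meval_eq => j.
  by rewrite tnth_pell_point /vcons liftK.
have pI := irreducible_head_poly (prime_irreducible pp).
(* The prime [p] involves u_2: a polynomial in sigma alone vanishing at these points is zero. *)
have sp : (1 < size (head_poly p))%N.
  rewrite ltnNge; apply/negP => /size1_polyC e.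
  have ep : p = shift_vars (head_poly p)`_0 by rewrite -unhead_polyC -e head_polyK.
  case: pp => /eqP[]; rewrite ep; suff -> : (head_poly p)`_0 = 0 by rewrite rmorph0.
  by apply: dense => D B C /hp; rewrite {1}ep.
case: (divides_or_resultant (@factorial_mpoly_int _) (head_poly g) pI sp).
  case=> k ek; exists (unhead_poly k).
  by rewrite -[g]head_polyK ek rmorphM /= head_polyK.
case=> s [t [c [c0 ec]]]; case/eqP: c0; apply: dense => D B C h.
by rewrite -unhead_polyC ec rmorphD !rmorphM /= !head_polyK rmorphD !rmorphM /= hp // hg //
  !mul0r addr0.
Qed.

Theorem mainTheorem4 (R : realType) (m : nat) (hm : (2 <= m)%N)
    (alpha beta : {mpoly int[(2 * m).+2]})
    (halpha : @is_generalized_heron R (2 * m).+1 alpha)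
    (hbeta : @expressed_in_u2_sigma (2 * m).+1 alpha beta) :
  zariski_closure
    ((@pi_projection R[i] m) @` ((@f_morphism R[i] m) @^-1` (@X_variety R[i] m)))
  = zero_locus [set map_mpoly intr beta].
Proof.
have m1 : (1 <= m)%N by apply: ltnW.
have [alphaI _ alphaV] := halpha.
have betaV := heron_on_pell m1 alphaV hbeta.
(* The zero locus of [beta] is closed and contains the image. Conversely, any [p] vanishing on the
   image must be shown to vanish on this locus. *)
apply/seteqP; split=> [y yS|y yV Z [[I ->] imI] p Ip].
  apply: yS; split; first by exists [set map_mpoly intr beta].
  move=> _ [x fx <-] _ ->.
  have [D [B [C [h ->]]]] := pi_projection_pell hm fx.
  exact: betaV.
have alpha0 : alpha != 0.
  apply/eqP => a0; have [_] := alphaI; case/(_ 0 0); first by rewrite a0 mulr0.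
    by rewrite unitr0.
  by rewrite unitr0.
have alphaP := factorial_irreducible_prime (@factorial_mpoly_int _) alpha0 alphaI.
have beta0 : beta != 0.
  apply/eqP => b0; case/eqP: alpha0; apply: scale4_inj; rewrite rmorph0.
  by move: hbeta; rewrite /expressed_in_u2_sigma b0 comp_mpoly0.
(* These parameters give the origin, the zero of [beta] used to select a prime factor. *)
have hp : pell_params m (1 : {poly R[i]}) 0 0.
  by split; [rewrite coef1 | rewrite size_poly1 | rewrite size_poly0 | rewrite size_poly0].
have [p0 [pp pV]] := prime_factor_of_heron alphaP hbeta beta0 (betaV _ _ _ hp).
have [es [ps [free_es ep]]] := mpoly_zfree_decomposition p.
have intV (g : {mpoly int[(2 * m).+2]}) D B C :
    (map_mpoly intr g).@[tnth (pell_point m (map_poly intr D) (map_poly intr B)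
      (map_poly intr C))] = (g.@[tnth (pell_point m D B C)])%:~R :> R[i].
  rewrite -meval_map_mpoly; apply: meval_eq => i; exact: tnth_pell_point_map.
have intP D B C : pell_params m D B C -> pell_params m
    (map_poly (intr : int -> R[i]) D) (map_poly intr B) (map_poly intr C).
  exact: pell_params_map.
have p0V D B C : pell_params m D B C -> p0.@[tnth (pell_point m D B C)] = 0.
  move=> /intP h; have /pV := betaV _ _ _ h; rewrite intV => /eqP.
  by rewrite intr_eq0 => /eqP.
(* An integral parameter point lies in the image, so [p] vanishes there, and freeness passes this on
   to each component. *)
have psV i : (i < size es)%N -> forall D B C : {poly int}, pell_params m D B C ->
    (ps i).@[tnth (pell_point m D B C)] = 0.
  move=> ies D B C h; apply: (zfree_components_vanish free_es) ies; rewrite -ep.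
  have [x [fx px]] := pell_pi_projection hm (intP _ _ _ h).
  rewrite -[RHS](imI (pell_point m (map_poly intr D) (map_poly intr B)
    (map_poly intr C)) _ p Ip); last by exists x.
  by apply: meval_eq => j; rewrite tnth_pell_point_map.
(* Every component is a multiple of [p0], which vanishes at [y] along with [beta]. *)
rewrite ep rmorph_sum /= big1 // => i _; rewrite mevalZ.
have dv := divides_of_vanishing_on_pell m1 pp p0V (psV i (ltn_ord i)).
have p0y : (map_mpoly intr p0).@[tnth y] = 0 by apply: (proj1 (pV _)); exact: yV.
exact: etrans (congr1 (fun a => es`_i * a) (divides_meval_eq0 dv p0y)) (mulr0 _).
Qed.
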